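(* There exist constants $c,\alpha_0>0$ such that for every $0<\alpha\le\alpha_0$, every $0<\epsilon\le\alpha^{12}$ and every positive integer $N\le \mathrm{tower}(c\log(1/\epsilon))$, there exists $A\subset[N]$ with $|A|\ge\alpha N$ such that for every positive integer $d\le N/2$, one has $x,x+d,x+2d\in A$ for at most $(\alpha^3-\epsilon)(N-2d)$ many integers $x$.
   Context: $[N]=\{1,\dots,N\}$. $\mathrm{tower}(m)$ denotes an exponential tower of twos of height $m$: $\mathrm{tower}(0)=1$ and $\mathrm{tower}(m+1)=2^{\mathrm{tower}(m)}$ for integers $m\ge 0$; for a real number $x\ge 0$, $\mathrm{tower}(x)$ means $\mathrm{tower}(\lfloor x\rfloor)$. $\log$ is the natural logarithm (the base is immaterial up to changing the constant). *)

(* Defs.v *)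
From mathcomp Require Import all_boot all_order all_algebra finmap reals exp.

Set Implicit Arguments.
Unset Strict Implicit.
Unset Printing Implicit Defensive.

Import Order.TTheory GRing.Theory Num.Theory.

Local Open Scope ring_scope.
Local Open Scope fset_scope.

Fixpoint tower (m : nat) : nat :=
  if m is m'.+1 then (2 ^ tower m')%N else 1%N.

(* [Num.truncn x] is the floor of [x] when [0 <= x], and 0 otherwise. *)
Definition towerR (R : realType) (x : R) : nat := tower (Num.truncn x).

Definition interval1 (N : nat) : {fset nat} := [fset i in iota 1 N].

(* Since [x] itself has to lie in [A], counting the natural numbers [x] in [A]
   is the same as counting the integers [x]. *)
Definition num_3AP (A : {fset nat}) (d : nat) : nat :=
  #|` [fset x in A | (x + d \in A)%N && (x + 2 * d \in A)%N]|.

(* Main.v *)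
Require Import Defs.
From mathcomp Require Import all_boot all_order all_algebra finmap reals exp.
From mathcomp Require Import sequences trigo ring lra zify.

(** Rescale to functions [F] of mean 1 on Z/M.  A point mass perturbation of the
    constant function has fewer than expected three-term progressions with every
    nonzero difference, but it creates an excess in the third moment, that is, at
    difference 0.  Pass to Z/MP and, on a small proportion of the fibres [x] mod
    [M] on which [F] is still flat, replace [F] by a trigonometric profile
    [beta * phi (theta_x n / MP)] whose average third-order correlation is below
    [beta^3].  For differences divisible by [M] the fibres average, and for
    random frequencies [theta_x] all of them are controlled simultaneously even
    when [P] is exponential in the number of fibres; for the other differences
    generic frequencies make distinct fibres exactly uncorrelated, so the gain
    already obtained is not lost.  The excess grows by a constant factor at each
    step, which allows about [log (1/eps)] steps and hence a tower of that height.
    Finally the function is rounded to a set at random; leaving a short initial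
    segment empty takes care of the differences close to [N/2].  When [N] is
    polynomial in [1/alpha], a set without progressions is dense enough. *)

Set Implicit Arguments.
Unset Strict Implicit.
Unset Printing Implicit Defensive.

Import Order.TTheory GRing.Theory Num.Theory.

Local Open Scope ring_scope.

(** Two demands fix the number of modified fibres. The saving per fibre is a fixed fraction of
    [beta ^+ 3], so about [kap * M] fibres are needed to cancel the whole excess of the third
    moment. On those fibres the function rises to at most [2 * beta] and is no longer flat, so the
    new excess and the lost background are again proportional to [kap * M]. This ratio alone limits
    the number of steps: [kap] starts at [1 / r], with [r] a small power of [1 / eps] when many
    steps are needed, and has to stay below [1 / 3].

    All moduli are powers of 7. They are odd, so that [d] and [2 * d] vanish together, and prime to
    every nonzero integer of size at most 6, the range of the integer combinations that three
    frequencies in [-2, 2] produce.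

    The theorem concerns an interval and not a cycle, so a refinement is proved for sums over
    arbitrary intervals, with an error polynomial in the old modulus. Averaging over many periods
    removes this error from the cyclic inequalities handed to the next step; errors therefore never
    accumulate, and only the last step has to keep its own. *)

(** * Concentration of measure on finite products *)

(** Squaring [(1 - z / 2) * expR (z / 2) <= 1] reduces the claim to a polynomial inequality. The
    one-sided condition [z <= 1] is the source of the requirement [c i <= 1] in the moment bounds
    below. *)
Lemma expR_le_quad (R : realType) (z : R) : z <= 1 -> expR z <= 1 + z + 2 * z ^+ 2.
Proof.
move=> z1.
have h1 : 0 < 1 - z / 2 by lra.
have h2 := expR_ge1Dx (- (z / 2)).
have h3 : expR (- (z / 2)) * expR (z / 2) = 1 by rewrite -expRD addNr expR0.
have h4 := expR_gt0 (z / 2).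
have h5 : (1 - z / 2) * expR (z / 2) <= 1.
  by rewrite -[leRHS]h3 ler_pM2r //; lra.
have -> : expR z = expR (z / 2) * expR (z / 2) by rewrite -expRD; congr expR; field.
have h6 : ((1 - z / 2) * expR (z / 2)) * ((1 - z / 2) * expR (z / 2)) <= 1.
  by rewrite mulr_ile1 // mulr_ge0 // ltW.
rewrite -(ler_pM2l (mulr_gt0 h1 h1)).
apply: le_trans (_ : 1 <= _); first by apply: le_trans h6; nra.
have -> : (1 - z / 2) * (1 - z / 2) * (1 + z + 2 * z ^+ 2)
  = 1 + z ^+ 2 * ((1 - z) * (5 / 2 - z) / 2) by field.
rewrite lerDl mulr_ge0 ?sqr_ge0 // divr_ge0 //; nra.
Qed.

Section Product.

Variables (R : realType) (I T : finType) (mu : I -> T -> R).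
Hypothesis mu_ge0 : forall i t, 0 <= mu i t.
Hypothesis mu1 : forall i, \sum_t mu i t = 1.

Implicit Types (h g : {ffun I -> T} -> R) (w v : {ffun I -> T}).

Definition expect h : R := \sum_(w : {ffun I -> T}) (\prod_i mu i (w i)) * h w.

Definition upd (i : I) (t : T) w : {ffun I -> T} :=
  [ffun j => if j == i then t else w j].

Definition avg (i : I) h w : R := \sum_t mu i t * h (upd i t w).

Lemma weight_ge0 w : 0 <= \prod_i mu i (w i).
Proof. by apply: prodr_ge0 => i _. Qed.

Lemma expect_le h g : (forall w, h w <= g w) -> expect h <= expect g.
Proof. by move=> hg; apply: ler_sum => w _; rewrite ler_wpM2l ?weight_ge0. Qed.

Lemma eq_expect h g : h =1 g -> expect h = expect g.
Proof. by move=> hg; apply: eq_bigr => w _; rewrite hg. Qed.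

Lemma expectD h g : expect (fun w => h w + g w) = expect h + expect g.
Proof. by rewrite -big_split; apply: eq_bigr => w _; rewrite mulrDr. Qed.

Lemma expectZ a h : expect (fun w => a * h w) = a * expect h.
Proof. by rewrite mulr_sumr; apply: eq_bigr => w _; rewrite mulrCA. Qed.

Lemma expect_sum (J : Type) (r : seq J) (P : pred J) (h : J -> {ffun I -> T} -> R) :
  expect (fun w => \sum_(j <- r | P j) h j w) = \sum_(j <- r | P j) expect (h j).
Proof.
rewrite exchange_big /=; apply: eq_bigr => w _; by rewrite mulr_sumr.
Qed.

Lemma expect_prod (G : I -> T -> R) :
  expect (fun w => \prod_i G i (w i)) = \prod_i \sum_t mu i t * G i t.
Proof.
rewrite bigA_distr_bigA; apply: eq_bigr => w _.
by rewrite big_split.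
Qed.

Lemma expect_cst a : expect (fun=> a) = a.
Proof.
have := expect_prod (fun _ _ => 1).
rewrite (@eq_expect _ (fun=> 1)) => [E1|w]; last by rewrite big1.
have -> : expect (fun=> a) = a * expect (fun=> 1).
  by rewrite -expectZ; apply: eq_expect => w; rewrite mulr1.
rewrite E1 big1 ?mulr1 // => i _.
by rewrite -[RHS](mu1 i); apply: eq_bigr => t _; rewrite mulr1.
Qed.

Lemma expect_avg i h : expect (avg i h) = expect h.
Proof.
pose F w t := (\prod_j mu j (w j)) * mu i t * h (upd i t w).
have -> : expect (avg i h) = \sum_(p : {ffun I -> T} * T) F p.1 p.2.
  rewrite -(pair_bigA _ F) /=; apply: eq_bigr => w _.
  by rewrite mulr_sumr; apply: eq_bigr => t _; rewrite mulrA.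
(* Exchanging the fresh sample with the coordinate it replaces is an involution that preserves the
   joint weight. *)
pose sw (p : {ffun I -> T} * T) := (upd i p.2 p.1, p.1 i).
have swK : involutive sw.
  move=> [w t]; rewrite /sw /=; congr pair; last by rewrite ffunE eqxx.
  apply/ffunP => j; rewrite !ffunE; case: eqP => // ->.
  by [].
rewrite (reindex_inj (inv_inj swK)) /=.
transitivity (\sum_(p : {ffun I -> T} * T) (\prod_j mu j (p.1 j)) * h p.1 * mu i p.2).
  apply: eq_bigr => -[w t] _; rewrite /F /=.
  have -> : upd i (w i) (upd i t w) = w.
    by apply/ffunP => j; rewrite !ffunE; case: eqP => // ->.
  rewrite (bigD1 i) //= [in RHS](bigD1 i) //= ffunE eqxx.
  rewrite (eq_bigr (fun j => mu j (w j))); first by ring.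
  by move=> j /negPf ji; rewrite ffunE ji.
rewrite -(pair_bigA _ (fun w t => (\prod_j mu j (w j)) * h w * mu i t)) /=.
by apply: eq_bigr => w _; rewrite -mulr_sumr mu1 mulr1.
Qed.

Lemma expect_coord i (G : T -> R) : expect (fun w => G (w i)) = \sum_t mu i t * G t.
Proof.
rewrite -(expect_avg i) (@eq_expect _ (fun=> \sum_t mu i t * G t)) ?expect_cst // => w.
by apply: eq_bigr => t _; rewrite ffunE eqxx.
Qed.

Lemma expect_indep i (f : T -> R) g : (forall t w, g (upd i t w) = g w) ->
  expect (fun w => f (w i) * g w) = (\sum_t mu i t * f t) * expect g.
Proof.
move=> gi; rewrite -(expect_avg i) -expectZ; apply: eq_expect => w.
by rewrite mulr_suml; apply: eq_bigr => t _; rewrite ffunE eqxx gi mulrA.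
Qed.

Lemma updU i j t s w : i != j -> upd i t (upd j s w) = upd j s (upd i t w).
Proof.
move=> ij; apply/ffunP => k; rewrite !ffunE.
by case: eqP => // ->; rewrite (negPf ij).
Qed.

Lemma upd_same i t s w : upd i t (upd i s w) = upd i t w.
Proof. by apply/ffunP => k; rewrite !ffunE; case: eqP. Qed.

Definition bounded_diff h (c : I -> R) :=
  forall i s t w, `|h (upd i s w) - h (upd i t w)| <= c i.

Lemma bounded_diff_avg i h c : bounded_diff h c -> bounded_diff (avg i h) c.
Proof.
move=> hc j s t w; rewrite /avg -sumrB.
apply: le_trans (ler_norm_sum _ _ _) _.
have -> : c j = \sum_u mu i u * c j by rewrite -mulr_suml mu1 mul1r.
apply: ler_sum => u _; rewrite -mulrBr normrM ger0_norm // ler_wpM2l //.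
case: (eqVneq i j) => [->|ij]; last by rewrite !(updU _ _ _ ij).
by rewrite !upd_same subrr normr0 (le_trans _ (hc j u u w)).
Qed.

(** Around the conditional mean [m] the linear term of [expR_le_quad] averages to 0, and only the
    quadratic one, at most [2 * c i ^+ 2], is left. *)
Lemma avg_exp i h c w : bounded_diff h c -> c i <= 1 ->
  avg i (fun v => expR (h v)) w <= expR (avg i h w + 2 * c i ^+ 2).
Proof.
move=> hc ci1; set m := avg i h w.
have dev t : `|h (upd i t w) - m| <= c i.
  rewrite /m /avg -[X in `|X - _|]mul1r -(mu1 i) mulr_suml -sumrB.
  apply: le_trans (ler_norm_sum _ _ _) _.
  have -> : c i = \sum_u mu i u * c i by rewrite -mulr_suml mu1 mul1r.
  apply: ler_sum => u _; rewrite -mulrBr normrM ger0_norm // ler_wpM2l //.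
have ci0 (t : T) : 0 <= c i by apply: le_trans (dev t).
have -> : avg i (fun v => expR (h v)) w
   = expR m * \sum_t mu i t * expR (h (upd i t w) - m).
  rewrite mulr_sumr; apply: eq_bigr => t _.
  by rewrite mulrCA -expRD; congr (_ * expR _); ring.
rewrite expRD ler_pM2l ?expR_gt0 //.
apply: le_trans (expR_ge1Dx _).
have -> : 1 + 2 * c i ^+ 2
    = \sum_t mu i t * (1 + (h (upd i t w) - m) + 2 * c i ^+ 2).
  rewrite (eq_bigr (fun t => mu i t * (1 + 2 * c i ^+ 2)
        + (mu i t * h (upd i t w) - mu i t * m))); last by move=> t _; ring.
  rewrite big_split /= sumrB -!mulr_suml mu1 !mul1r.
  by rewrite -/(avg i h w) -/m subrr addr0.
apply: ler_sum => t _; rewrite ler_wpM2l //.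
have := dev t; rewrite ler_norml => /andP[d1 d2].
apply: le_trans (expR_le_quad _) _; first exact: le_trans d2 ci1.
rewrite lerD2l ler_wpM2l //.
by rewrite -real_normK ?num_real // lerXn2r ?nnegrE ?ci0.
Qed.

Lemma avg_foldr_const h w v : foldr avg h (enum I) w = foldr avg h (enum I) v.
Proof.
have indep (s : seq I) i t u : i \in s -> foldr avg h s (upd i t u) = foldr avg h s u.
  elim: s u => //= j s IH u; rewrite inE; case: (eqVneq i j) => [-> _|ij /= si].
    by apply: eq_bigr => x _; rewrite upd_same.
  by apply: eq_bigr => x _; rewrite updU ?IH // eq_sym.
(* Induction on a list of the coordinates where the two points may differ: they are reset one at a
   time. *)
suff H (s : seq I) (u : {ffun I -> T}) : (forall i, i \notin s -> u i = w i) ->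
    foldr avg h (enum I) u = foldr avg h (enum I) w.
  by symmetry; apply: (H (enum I)) => i; rewrite mem_enum.
elim: s u => [|j s IH] u hu.
  by have -> : u = w by apply/ffunP => i; rewrite hu.
rewrite -(indep _ j (w j)) ?mem_enum //; apply: IH => i si.
by rewrite ffunE; case: eqP => [->//|/eqP ij]; rewrite hu // inE (negPf ij).
Qed.

(* McDiarmid's inequality in exponential-moment form: average out one
   coordinate at a time. *)
Lemma expect_expR_le h c : bounded_diff h c -> (forall i, c i <= 1) ->
  expect (fun w => expR (h w)) <= expR (expect h + 2 * \sum_i c i ^+ 2).
Proof.
move=> hc c1.
have H (s : seq I) : bounded_diff (foldr avg h s) c /\
    expect (fun w => expR (h w))
    <= expect (fun w => expR (foldr avg h s w + 2 * \sum_(i <- s) c i ^+ 2)).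
  elim: s => [|i s [IH1 IH2]] /=.
    by split=> //; apply: expect_le => w; rewrite big_nil mulr0 addr0.
  split; first exact: bounded_diff_avg.
  apply: le_trans IH2 _; rewrite -(expect_avg i).
  apply: expect_le => w.
  have -> : avg i (fun v => expR (foldr avg h s v + 2 * \sum_(j <- s) c j ^+ 2)) w
      = expR (2 * \sum_(j <- s) c j ^+ 2) * avg i (fun v => expR (foldr avg h s v)) w.
    move: (\sum_(j <- s) c j ^+ 2) => S.
    by rewrite mulr_sumr; apply: eq_bigr => t _; rewrite expRD; ring.
  rewrite big_cons mulrDr [_ + (2 * _ + _)]addrA [expR (_ + 2 * \sum_(j <- s) _)]expRD.
  rewrite mulrC ler_pM2r ?expR_gt0 //.
  exact: avg_exp.
have [_ /le_trans] := H (enum I); apply.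
have [w0 _|w0] := pickP (fun _ : {ffun I -> T} => true); last first.
  by rewrite /expect big_pred0 ?expR_ge0 // => w; have := w0 w.
have E w : foldr avg h (enum I) w = expect h.
  have -> : expect h = expect (foldr avg h (enum I)).
    by elim: (enum I) => //= i s IH; rewrite expect_avg.
  rewrite (@eq_expect _ (fun=> foldr avg h (enum I) w)) ?expect_cst // => v.
  exact: avg_foldr_const.
rewrite (@eq_expect _ (fun=> expR (expect h + 2 * \sum_i c i ^+ 2))) ?expect_cst // => w.
by rewrite E big_enum.
Qed.

Lemma expect_lt1 h : expect h < 1 -> exists w, h w < 1.
Proof.
move=> h1; have [/existsP[w hw]|] := boolP [exists w, h w < 1]; first by exists w.
rewrite negb_exists => /forallP hge; suff : 1 <= expect h by rewrite leNgt h1.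
by rewrite -[X in X <= _](expect_cst 1); apply: expect_le => w; rewrite leNgt.
Qed.

(** A union bound over two kinds of events at once: [expR (h d w - tau d)] and the indicator of
    [bad b] are each at least 1 where their constraint fails, so an outcome at which their total is
    below 1 violates none. *)
Lemma exists_all_below (D B : finType) (h : D -> {ffun I -> T} -> R)
  (c : D -> I -> R) (tau : D -> R) (bad : B -> {ffun I -> T} -> bool) :
  (forall d, bounded_diff (h d) (c d)) -> (forall d i, c d i <= 1) ->
  \sum_d expR (expect (h d) + 2 * (\sum_i c d i ^+ 2) - tau d)
    + \sum_b expect (fun w => (bad b w)%:R) < 1 ->
  exists w, (forall d, h d w < tau d) /\ forall b, ~~ bad b w.
Proof.
move=> hc c1 lt1.
have [|w hw] := @expect_lt1 (fun w => \sum_d expR (- tau d) * expR (h d w) + \sum_b (bad b w)%:R).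
  rewrite expectD !expect_sum; apply: le_lt_trans lt1.
  rewrite lerD2r; apply: ler_sum => d _.
  by rewrite expectZ [leRHS]expRD mulrC ler_pM2r ?expR_gt0 // expect_expR_le.
exists w; split=> [d|b].
  rewrite -subr_lt0 -expR_lt1; apply: le_lt_trans hw.
  rewrite addrC expRD (bigD1 d) //= -addrA lerDl addr_ge0 //.
    by apply: sumr_ge0 => i _; rewrite mulr_ge0 ?expR_ge0.
  exact: sumr_ge0.
apply/negP => bw; move: hw; rewrite ltNge => /negP; apply.
rewrite (bigD1 b) //= bw addrCA lerDl addr_ge0 //; last exact: sumr_ge0.
by apply: sumr_ge0 => i _; rewrite mulr_ge0 ?expR_ge0.
Qed.

End Product.

(** * Trigonometric sums *)

Section TrigSums.

Variable R : realType.
Implicit Types (x h a phi : R).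

Lemma cosDnat2pi x n : cos (x + 2 * pi * n%:R) = cos x :> R.
Proof.
by rewrite -[RHS](periodicn (@cosD2pi R) n); congr cos; rewrite -[_ *+ n]mulr_natr -[pi *+ 2]mulr_natr; ring.
Qed.

Lemma sinDnat2pi x n : sin (x + 2 * pi * n%:R) = sin x :> R.
Proof.
by rewrite -[RHS](periodicn (@sinD2pi R) n); congr sin; rewrite -[_ *+ n]mulr_natr -[pi *+ 2]mulr_natr; ring.
Qed.

Lemma sinDint2pi x (n : int) : sin (x + 2 * pi * n%:~R) = sin x :> R.
Proof.
case: n => n; first exact: sinDnat2pi.
rewrite -[LHS](sinDnat2pi _ n.+1); congr sin.
by rewrite NegzE mulrNz; ring.
Qed.

Lemma cosDint2pi x (n : int) : cos (x + 2 * pi * n%:~R) = cos x :> R.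
Proof.
case: n => n; first exact: cosDnat2pi.
rewrite -[LHS](cosDnat2pi _ n.+1); congr cos.
by rewrite NegzE mulrNz; ring.
Qed.

Lemma cos_sum_telescope x h L :
  2 * sin (h / 2) * \sum_(y < L) cos (x + h * y%:R)
  = sin (x + h * L%:R - h / 2) - sin (x - h / 2) :> R.
Proof.
elim: L => [|L IH]; first by rewrite big_ord0 !mulr0 addr0 subrr.
rewrite big_ord_recr /= mulrDr IH.
have -> : x + h * L.+1%:R - h / 2 = (x + h * L%:R) + h / 2 by rewrite -natr1; field.
by rewrite (sinD (_ + _) (h / 2)) (sinB (_ + _) (h / 2)); ring.
Qed.

Lemma cos_sum_bound x h L : `|sin (h / 2)| * `|\sum_(y < L) cos (x + h * y%:R)| <= 1 :> R.
Proof.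
have := congr1 Num.norm (cos_sum_telescope x h L).
rewrite !normrM (ger0_norm (ler0n _ 2)) => E.
suff : 2 * (`|sin (h / 2)| * `|\sum_(y < L) cos (x + h * y%:R)|) <= 2 :> R by lra.
rewrite mulrA E; apply: le_trans (ler_normB _ _) _.
by have := sin_max (x + h * L%:R - h / 2); have := sin_max (x - h / 2); lra.
Qed.

Lemma sin_pi_frac_neq0 P (j : int) : (0 < P)%N -> ~~ (P %| `|j|)%N ->
  sin (pi * j%:~R / P%:R) != 0 :> R.
Proof.
move=> P0; have P0R : 0 < P%:R :> R by rewrite ltr0n.
have aux n : ~~ (P %| n)%N -> sin (pi * n%:R / P%:R) != 0 :> R.
  rewrite /dvdn => nP.
  have -> : pi * n%:R / P%:R = pi * (n %% P)%:R / P%:R + pi *+ (n %/ P) :> R.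
    by rewrite {1}(divn_eq n P) natrD natrM -[pi *+ _]mulr_natr; field; rewrite lt0r_neq0.
  rewrite (alternatingn (@sinDpi R)) mulf_neq0 ?signr_eq0 //.
  rewrite gt_eqF // sin_gt0_pi //; apply/andP; split.
    by rewrite !mulr_gt0 ?invr_gt0 ?pi_gt0 // ltr0n lt0n.
  rewrite ltr_pdivrMr // ltr_pM2l ?pi_gt0 // ltr_nat ltn_mod //.
case: j => n; first exact: aux.
move=> /aux; rewrite NegzE abszN /= mulrNz mulrN mulNr sinN oppr_eq0 //.
Qed.

Lemma cos_sum_eq0 P (j : int) x : (0 < P)%N -> ~~ (P %| `|j|)%N ->
  \sum_(y < P) cos (x + 2 * pi * j%:~R / P%:R * y%:R) = 0 :> R.
Proof.
move=> P0 Pj; have := cos_sum_telescope x (2 * pi * j%:~R / P%:R) P.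
have P0R : P%:R != 0 :> R by rewrite pnatr_eq0 -lt0n.
have -> : 2 * pi * j%:~R / P%:R / 2 = pi * j%:~R / P%:R :> R by field.
have -> : x + 2 * pi * j%:~R / P%:R * P%:R - pi * j%:~R / P%:R
    = x - pi * j%:~R / P%:R + 2 * pi * j%:~R :> R by field.
rewrite sinDint2pi subrr => /eqP; rewrite mulf_eq0 => /orP[|/eqP//].
by rewrite mulf_eq0 pnatr_eq0 /= => /negPn; rewrite sin_pi_frac_neq0.
Qed.

Lemma sin_nat_le a n : `|sin (n%:R * a)| <= n%:R * `|sin a| :> R.
Proof.
elim: n => [|n IH]; first by rewrite !mul0r sin0 normr0.
rewrite -natr1 !mulrDl !mul1r sinD; apply: le_trans (ler_normD _ _) _.
rewrite !normrM; apply: lerD.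
  by apply: le_trans IH; rewrite ler_piMr // cos_max.
by rewrite ler_piMl // cos_max.
Qed.

(** The left side is the squared modulus of the sum of [exp (2 i j a)] over [j < J], a Fejer kernel
    in real form. *)
Lemma fejer_expand a J :
  (\sum_(j < J) cos (2 * j%:R * a)) ^+ 2 + (\sum_(j < J) sin (2 * j%:R * a)) ^+ 2
  = \sum_(j < J) \sum_(i < J) cos (2 * (j%:R - i%:R) * a) :> R.
Proof.
rewrite !expr2 !mulr_suml -big_split; apply: eq_bigr => j _ /=.
rewrite !mulr_sumr -big_split; apply: eq_bigr => i _ /=.
by rewrite -cosB; congr cos; ring.
Qed.

(** Off the diagonal [0 < |j - i| < P], so [P] does not divide [k * (j - i)] and the sum over [t]
    vanishes; the [J] diagonal terms give [P] each. *)
Lemma fejer_sum P J (k : int) phi : (0 < P)%N -> (J <= P)%N -> coprime P `|k| ->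
  \sum_(t < P) \sum_(j < J) \sum_(i < J)
     cos (2 * (j%:R - i%:R) * (pi * k%:~R * t%:R / P%:R + phi)) = (J * P)%:R :> R.
Proof.
move=> P0 JP kP; rewrite exchange_big /=.
rewrite (eq_bigr (fun=> P%:R)); last first.
  move=> j _; rewrite exchange_big (bigD1 j) //= [X in _ + X]big1 ?addr0.
    under eq_bigr do rewrite subrr mulr0 mul0r cos0.
    by rewrite sumr_const card_ord.
  move=> i ij.
  rewrite -[RHS](@cos_sum_eq0 P (k * (j%:Z - i%:Z)) (2 * (j%:R - i%:R) * phi)) //.
    apply: eq_bigr => t _; congr cos.
    by rewrite intrM intrB; field; rewrite pnatr_eq0 -lt0n.
  rewrite abszM Gauss_dvdr //; apply/negP => /dvdn_leq.
  have := ltn_ord i; have := ltn_ord j; move: ij; rewrite -val_eqE /=; lia.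
by rewrite sumr_const card_ord natrM mulr_natl.
Qed.

(* If [|sin a| < eta] then the first [J] harmonics of [a] are all aligned, so
   [a] carries a large Fejer kernel, whose mean over [t] is known. *)
Lemma card_small_sin P J (k : int) phi (eta : R) :
  (0 < J)%N -> (J <= P)%N -> coprime P `|k| -> J%:R * eta <= 1 / 2 ->
  #|[set t : 'I_P | `|sin (pi * k%:~R * t%:R / P%:R + phi)| < eta]|%:R * J%:R
    <= 4 * P%:R :> R.
Proof.
move=> J0 JP kP Jeta; have P0 := leq_trans J0 JP.
have J0R : 0 < J%:R :> R by rewrite ltr0n.
set A := [set t | _].
have key (t : 'I_P) : (t \in A)%:R * (J%:R ^+ 2 / 4) <= \sum_(j < J) \sum_(i < J)
     cos (2 * (j%:R - i%:R) * (pi * k%:~R * t%:R / P%:R + phi)) :> R.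
  have At : (t \in A) = (`|sin (pi * k%:~R * t%:R / P%:R + phi)| < eta) by rewrite inE.
  rewrite -fejer_expand; move: (pi * _ * _ / _ + phi) At => a.
  case: (t \in A) => At; last by rewrite mul0r addr_ge0 ?sqr_ge0.
  rewrite mul1r; move/esym: At => sa.
  have eta0 : 0 < eta by exact: le_lt_trans (normr_ge0 _) sa.
  have hc (j : 'I_J) : 1 / 2 <= cos (2 * j%:R * a).
    have -> : cos (2 * j%:R * a) = 1 - 2 * sin (j%:R * a) ^+ 2.
      by rewrite sin2cos2 -mulrA mulr_natl cos_mulr2n -[_ *+ 2]mulr_natr; ring.
    have : `|sin (j%:R * a)| <= 1 / 2.
      apply: le_trans (sin_nat_le _ _) _; apply: le_trans Jeta.
      by apply: ler_pM => //; [rewrite ler_nat ltnW|exact: ltW].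
    by rewrite ler_norml => /andP[]; nra.
  have hJ : J%:R / 2 <= \sum_(j < J) cos (2 * j%:R * a).
    have -> : J%:R / 2 = \sum_(j < J) (1 / 2) :> R by rewrite sumr_const card_ord -[RHS]mulr_natr; field.
    by apply: ler_sum => j _; apply: hc.
  apply: le_trans (_ : (\sum_(j < J) cos (2 * j%:R * a)) ^+ 2 <= _); last by rewrite lerDl sqr_ge0.
  have -> : J%:R ^+ 2 / 4 = (J%:R / 2) ^+ 2 :> R by field.
  by rewrite lerXn2r ?nnegrE ?divr_ge0 //; apply: le_trans hJ; rewrite divr_ge0.
have : \sum_(t < P) (t \in A)%:R * (J%:R ^+ 2 / 4) <= (J * P)%:R :> R.
  by rewrite -(@fejer_sum P J k phi) //; apply: ler_sum => t _; apply: key.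
rewrite natrM.
rewrite -mulr_suml -natr_sum.
have -> : (\sum_(t < P) (t \in A))%N = #|A| 
  by rewrite -sum1_card [RHS]big_mkcond; apply: eq_bigr => t _; case: (t \in A).
move=> H; rewrite -(ler_pM2r J0R); nra.
Qed.

End TrigSums.

(** * The fibre profile *)

Definition freq (k : 'I_5) : int := (k : nat)%:Z - 2.

(** Exponential coefficients of [1 + cos x / 2 - cos (2 * x) / 2] at the frequencies -2, ..., 2.
    This has mean 1 and values in [0, 2]; the minus sign at the second harmonic is what pushes the
    third-order correlation below 1. *)
Definition amp (R : realType) (k : 'I_5) : R :=
  nth 0 [:: - (1 / 4); 1 / 4; 1; 1 / 4; - (1 / 4)] k.

Section TrigPoly.

Variable R : realType.
Implicit Types (a b c : 'I_5 -> R) (x t : R).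

Definition symmetric_coef a := forall k, a (rev_ord k) = a k.

Definition trigpoly a x : R := \sum_k a k * cos ((freq k)%:~R * x).

Lemma sum_ord5 (V : nmodType) (f : 'I_5 -> V) :
  \sum_k f k = f (inord 0) + f (inord 1) + f (inord 2) + f (inord 3) + f (inord 4).
Proof.
rewrite !big_ord_recl big_ord0 addr0 !addrA.
by do !congr (_ + _); congr f; apply: val_inj; rewrite /= inordK.
Qed.

Lemma freq_inord i : (i < 5)%N -> freq (inord i) = i%:Z - 2.
Proof. by move=> i5; rewrite /freq inordK. Qed.

Lemma symmetric_sin_sum a x : symmetric_coef a ->
  \sum_k a k * sin ((freq k)%:~R * x) = 0.
Proof.
move=> sa; set S := \sum_k _.
have : S = - S.
  rewrite {1}/S (reindex_inj rev_ord_inj) /= -sumrN; apply: eq_bigr => k _.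
  rewrite sa -mulrN -sinN; congr (_ * sin _).
  rewrite -mulNr -intrN; congr (_%:~R * _).
  by rewrite /freq /=; have := ltn_ord k; lia.
by move=> /eqP; rewrite -addr_eq0 -mulr2n mulrn_eq0 /= => /eqP.
Qed.

(** Replaces the multiplication of complex exponentials: the sine parts cancel in pairs of opposite
    frequencies, so a product of trigonometric polynomials expands into single cosines of summed
    phases. *)
Lemma symmetric_cos_sum a x t : symmetric_coef a ->
  \sum_k a k * cos (t + (freq k)%:~R * x) = cos t * trigpoly a x.
Proof.
move=> sa.
rewrite (eq_bigr (fun k => cos t * (a k * cos ((freq k)%:~R * x))
    - sin t * (a k * sin ((freq k)%:~R * x)))).
  by rewrite sumrB -!mulr_sumr symmetric_sin_sum // mulr0 subr0.
by move=> k _; rewrite cosD; ring.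
Qed.

Lemma trigpoly_prod a b c x y z :
  symmetric_coef a -> symmetric_coef b -> symmetric_coef c ->
  trigpoly a x * trigpoly b y * trigpoly c z
  = \sum_i \sum_j \sum_k a i * b j * c k *
      cos ((freq i)%:~R * x + (freq j)%:~R * y + (freq k)%:~R * z).
Proof.
move=> sa sb sc.
rewrite {1}/trigpoly !mulr_suml; apply: eq_bigr => i _.
rewrite -[a i * _ * _]mulrA -[a i * _ * _]mulrA mulrA -(@symmetric_cos_sum b) //.
rewrite mulr_sumr mulr_suml; apply: eq_bigr => j _.
rewrite -[a i * _ * _]mulrA -[b j * _ * _]mulrA -(@symmetric_cos_sum c) //.
by rewrite !mulr_sumr; apply: eq_bigr => k _; rewrite !mulrA.
Qed.

Lemma amp_sym : symmetric_coef (@amp R).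
Proof. by case=> [[|[|[|[|[|//]]]]] h]. Qed.

(* The diagonal third-order correlation of the fibre profile with
   difference [t]: only total frequency zero survives averaging over the
   base point. *)
Definition triple_corr t : R :=
  \sum_i \sum_j \sum_k (freq i + freq j + freq k == 0)%:R *
    (amp R i * amp R j * amp R k) * cos ((freq j + 2 * freq k)%:~R * t).

Lemma sum_norm_amp : \sum_k `|amp R k| = 2.
Proof.
rewrite sum_ord5 /amp !inordK //= normrN normr1 !(ger0_norm (_ : 0 <= 1 / 4)) //; lra.
Qed.

Lemma triple_corr_max t : `|triple_corr t| <= 8.
Proof.
have -> : 8 = \sum_i \sum_j \sum_k `|amp R i| * `|amp R j| * `|amp R k|.
  under eq_bigr do under eq_bigr do rewrite -mulr_sumr.
  under eq_bigr do rewrite -mulr_suml -mulr_sumr.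
  by rewrite -!mulr_suml sum_norm_amp; ring.
apply: le_trans (ler_norm_sum _ _ _) _; apply: ler_sum => i _.
apply: le_trans (ler_norm_sum _ _ _) _; apply: ler_sum => j _.
apply: le_trans (ler_norm_sum _ _ _) _; apply: ler_sum => k _.
rewrite !normrM -[leRHS]mulr1 ler_pM //; last exact: cos_max.
  by rewrite !mulr_ge0.
by case: eqP => _; rewrite ?normr1 ?normr0 ?mul1r ?mul0r ?mulr_ge0.
Qed.

Lemma triple_corrDnat2pi t (n : nat) : triple_corr (t + 2 * pi * n%:R) = triple_corr t.
Proof.
apply: eq_bigr => i _; apply: eq_bigr => j _; apply: eq_bigr => k _.
congr (_ * _); rewrite -[RHS](cosDint2pi _ ((freq j + 2 * freq k) * n%:Z)).
by congr cos; rewrite intrM; ring.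
Qed.

(** A term survives when [i + j + k = 0] and [j + 2 * k = 0] as frequencies, that is for triples
    [(f, -2 f, f)] with [f] in {-1, 0, 1}. These contribute [1 + 2 * (1 / 4) ^ 2 * (- (1 / 4)) = 1 -
    1 / 32]. As [|j + 2 * k| <= 6], a nonzero value is prime to 7. *)
Lemma triple_corr_mean e (d : nat) : ~~ (7 ^ e %| d)%N ->
  \sum_(t < 7 ^ e) triple_corr (2 * pi * d%:R / (7 ^ e)%:R * t%:R)
  = (7 ^ e)%:R * (1 - 1 / 32).
Proof.
move=> Pd; have P0 : (0 < 7 ^ e)%N by rewrite expn_gt0.
have cosum (i : int) : (`|i| <= 6)%N ->
    \sum_(t < 7 ^ e) cos (i%:~R * (2 * pi * d%:R / (7 ^ e)%:R * t%:R))
    = (7 ^ e)%:R * (i == 0)%:R :> R.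
  move=> i6; case: eqP => [->|/eqP i0].
    under eq_bigr do rewrite mul0r cos0.
    by rewrite sumr_const card_ord mulr1.
  rewrite mulr0 -[RHS](@cos_sum_eq0 R (7 ^ e) (d%:Z * i) 0) //.
    apply: eq_bigr => t _; congr cos; rewrite add0r intrM; field.
    by rewrite pnatr_eq0 -lt0n.
  rewrite abszM Gauss_dvdl // coprimeXl // prime_coprime //.
  apply/negP => /dvdn_leq; lia.
rewrite (eq_bigr (fun t : 'I_(7 ^ e) => \sum_i \sum_j \sum_k (freq i + freq j + freq k == 0)%:R *
    (amp R i * amp R j * amp R k) *
    cos ((freq j + 2 * freq k)%:~R * (2 * pi * d%:R / (7 ^ e)%:R * (t : nat)%:R)))) //.
rewrite exchange_big /=.
under eq_bigr do rewrite exchange_big /=.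
under eq_bigr do under eq_bigr do rewrite exchange_big /=.
transitivity (\sum_i \sum_j \sum_k (7 ^ e)%:R * ((freq i + freq j + freq k == 0)%:R *
    (amp R i * amp R j * amp R k) * (freq j + 2 * freq k == 0)%:R)).
  apply: eq_bigr => i _; apply: eq_bigr => j _; apply: eq_bigr => k _.
  rewrite -mulr_sumr cosum; first by ring.
  by rewrite /freq; have := ltn_ord j; have := ltn_ord k; lia.
under eq_bigr do under eq_bigr do rewrite -mulr_sumr.
under eq_bigr do rewrite -mulr_sumr.
rewrite -mulr_sumr; congr (_ * _).
rewrite !sum_ord5 !freq_inord // /amp !inordK //=.
by field.
Qed.

End TrigPoly.

(** The cost of the union bound over at most [2 ^ k] differences; the other half is reserved for the
    degenerate linear forms. *)
Lemma pow2_expR_lt (R : realType) k : 2 ^+ k * expR (- k.+1%:R) < 1 / 2 :> R.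
Proof.
have e1 : 2 < expR 1 :> R by have := @expR_gt1Dx R 1 (oner_neq0 _); lra.
have e2 : 2 ^+ k.+1 < expR k.+1%:R :> R.
  rewrite -[k.+1%:R]mulr1 expRM_natl ltrXn2r //; lra.
have := expRxMexpNx_1 (k.+1%:R : R); move: e2; rewrite exprS.
move: (expR_gt0 (- k.+1%:R : R)) (exprn_gt0 k (ltr0n R 2)).
move: (expR _) (expR _) (2 ^+ k) => u v w v0 w0; nra.
Qed.

(** * Random frequencies for the fibres *)

Section Frequencies.

Variables (R : realType) (M : nat).

(** The three base points may coincide, so coefficients are collected per variable. This separates
    the forms that vanish identically, which produce main terms, from those that a choice of [th]
    can keep away from 0. *)
Definition lin_coef (b : ('I_M * 'I_M * 'I_M) * ('I_5 * 'I_5 * 'I_5)) (y : 'I_M) : int :=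
  let: ((x1, x2, x3), (k1, k2, k3)) := b in
  (x1 == y)%:Z * freq k1 + (x2 == y)%:Z * freq k2 + (x3 == y)%:Z * freq k3.

Definition lin_form (b : ('I_M * 'I_M * 'I_M) * ('I_5 * 'I_5 * 'I_5))
    (th : 'I_M -> nat) : int :=
  let: ((x1, x2, x3), (k1, k2, k3)) := b in
  freq k1 * (th x1)%:Z + freq k2 * (th x2)%:Z + freq k3 * (th x3)%:Z.

Lemma lin_formE b th : lin_form b th = \sum_y lin_coef b y * (th y)%:Z.
Proof.
case: b => [[[x1 x2] x3] [[k1 k2] k3]]; rewrite /lin_form /lin_coef.
have E x (k : int) : k * (th x)%:Z = \sum_y (x == y)%:Z * k * (th y)%:Z.
  rewrite (bigD1 x) //= eqxx mul1r big1 ?addr0 // => y /negPf.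
  by rewrite eq_sym => ->; rewrite !mul0r.
rewrite !E -!big_split; apply: eq_bigr => y _ /=; by rewrite -!mulrDl.
Qed.

Lemma lin_coef_le b y : (`|lin_coef b y| <= 6)%N.
Proof.
case: b => [[[x1 x2] x3] [[k1 k2] k3]]; rewrite /lin_coef /freq.
have := ltn_ord k1; have := ltn_ord k2; have := ltn_ord k3.
by do 3 case: (_ == y); lia.
Qed.

(** The frequencies are uniform and independent. The correlation sum over [S] has mean
    [#|S| * (1 - 1 / 32)] and concentrates, half of the saving being given up to deviations; each
    nontrivial form is close to 0 with probability at most [4 / J]. *)
Lemma exists_frequencies (e k J : nat) (S : {set 'I_M}) :
  (0 < M)%N -> J = (1000 * M ^ 3)%N -> (J <= 7 ^ e)%N -> (7 ^ e <= 2 ^ k)%N ->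
  2 ^+ 23 * k.+1%:R <= #|S|%:R :> R ->
  exists th : {ffun 'I_M -> 'I_(7 ^ e)},
    (forall b, [exists y, lin_coef b y != 0] ->
      (2 * J%:R)^-1 <= `|sin (pi * (lin_form b (fun x => th x))%:~R / (7 ^ e)%:R)| :> R) /\
    (forall d : nat, ~~ (7 ^ e %| d)%N ->
      \sum_(x in S) @triple_corr R (2 * pi * d%:R / (7 ^ e)%:R * (th x)%:R)
        <= #|S|%:R * (1 - 1 / 64)).
Proof.
move=> M0 JE JP P2k mk.
set P := (7 ^ e)%N in JP P2k *.
have P0 : (0 < P)%N by rewrite expn_gt0.
have PR : 0 < P%:R :> R by rewrite ltr0n.
have J0 : (0 < J)%N by rewrite JE muln_gt0 expn_gt0 M0.
have JR : 0 < J%:R :> R by rewrite ltr0n.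
pose mu (_ : 'I_M) (_ : 'I_P) : R := P%:R^-1.
have mu0 i t : 0 <= mu i t by rewrite invr_ge0 ler0n.
have mu1 i : \sum_t mu i t = 1.
  by rewrite sumr_const card_ord -[LHS]mulr_natr mulVf // pnatr_eq0 -lt0n.
(* [lam] minimizes the exponent [2 * (16 * lam) ^ 2 - lam / 64] per fibre, with value
   [- 1 / 2 ^ 23]. *)
have [lam lam0 lamE] : exists2 lam : R, 0 < lam & lam = 2^-1 ^+ 16.
  by exists (2^-1 ^+ 16) => //; rewrite exprn_gt0 // invr_gt0.
pose ang (d t : nat) : R := 2 * pi * d%:R / P%:R * t%:R.
pose h (d : 'I_P) (th : {ffun 'I_M -> 'I_P}) : R :=
  \sum_x lam * ((x \in S)%:R * @triple_corr R (ang d (th x))).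
pose c (d : 'I_P) (x : 'I_M) : R := (x \in S)%:R * (16 * lam).
pose tau (d : 'I_P) := expect mu (h d) + lam * (#|S|%:R / 64).
pose eta : R := (2 * J%:R)^-1.
pose bad (b : ('I_M * 'I_M * 'I_M) * ('I_5 * 'I_5 * 'I_5)) (th : {ffun 'I_M -> 'I_P}) :=
  [exists y, lin_coef b y != 0] &&
    (`|sin (pi * (lin_form b (fun x => th x))%:~R / P%:R)| < eta).
have hc d : bounded_diff (h d) (c d).
  move=> i s t w; rewrite /h -sumrB (bigD1 i) //= big1 ?addr0; last first.
    by move=> x /negPf xi; rewrite !ffunE xi subrr.
  rewrite !ffunE eqxx -!mulrBr !normrM (gtr0_norm lam0) normr_nat /c.
  rewrite mulrCA ler_wpM2l // mulrC ler_pM2r //.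
  apply: le_trans (ler_normB _ _) _.
  by have := triple_corr_max (ang d s); have := triple_corr_max (ang d t); lra.
have c1 d i : c d i <= 1.
  rewrite /c lamE; case: (i \in S); last by rewrite mul0r.
  by rewrite mul1r; lra.
have eh (d : 'I_P) : ~~ (P %| d)%N -> expect mu (h d) = lam * (#|S|%:R * (1 - 1 / 32)).
  move=> Pd; rewrite /h expect_sum.
  transitivity (\sum_(x in S) lam * (1 - 1 / 32) : R).
    rewrite [RHS]big_mkcond; apply: eq_bigr => x _; rewrite !expectZ.
    case: (x \in S); last by rewrite mul0r mulr0.
    rewrite (mul1r (expect _ _)) (expect_coord mu1 x (fun t : 'I_P => @triple_corr R (ang d t))).
    rewrite -mulr_sumr triple_corr_mean //.
    by rewrite mulKf ?gt_eqF.
  by rewrite sumr_const -[LHS]mulr_natl; ring.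
have ebad b : expect mu (fun th => (bad b th)%:R) <= 4 / J%:R.
  have J4 : 0 <= 4 / J%:R :> R by rewrite divr_ge0.
  rewrite /bad; case: existsP => [[y cy]|_] /=; last by rewrite expect_cst.
  (* Only one variable [th y] with nonzero coefficient is resampled; that coefficient is at most 6
     in size, hence prime to 7, and [card_small_sin] applies for any values of the others. *)
  rewrite -(expect_avg mu1 y) -[leRHS](expect_cst mu1).
  apply: expect_le => // w.
  pose phi : R := pi * (\sum_(z | z != y) lin_coef b z * (w z)%:Z)%:~R / P%:R.
  have E t : lin_form b (fun x => (upd y t w) x)
      = lin_coef b y * (t : 'I_P)%:Z + \sum_(z | z != y) lin_coef b z * (w z)%:Z.
    rewrite lin_formE (bigD1 y) //= ffunE eqxx; congr (_ + _).
    by apply: eq_bigr => z /negPf zy; rewrite ffunE zy.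
  have := @card_small_sin R P J (lin_coef b y) phi eta J0 JP.
  have cop : coprime P `|lin_coef b y|.
    rewrite coprimeXl // prime_coprime //; apply/negP => /dvdn_leq.
    have := lin_coef_le b y; lia.
  have Jeta : J%:R * eta <= 1 / 2.
    by rewrite /eta invfM mulrCA mulfV ?gt_eqF //; lra.
  move=> /(_ cop Jeta); set A := [set t | _] => hA.
  have -> : avg mu y (fun th => (`|sin (pi * (lin_form b (fun x => th x))%:~R / P%:R)| < eta)%R%:R) w
      = P%:R^-1 * #|A|%:R.
    rewrite /avg -mulr_sumr -natr_sum -sum1_card [in RHS]big_mkcond /=.
    congr (_ * _%:R); apply: eq_bigr => t _; rewrite E inE.
    have -> : pi * (lin_coef b y * t%:Z + \sum_(z | z != y) lin_coef b z * (w z)%:Z)%:~R / P%:R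
        = pi * (lin_coef b y)%:~R * t%:R / P%:R + phi.
      by rewrite /phi intrD intrM; field; rewrite gt_eqF.
    by case: (_ < _).
  by rewrite ler_pdivlMr // -mulrA mulrC ler_pdivrMr.
have [|th [hlow hbad]] := exists_all_below (tau := tau) (bad := bad) mu0 mu1 hc c1.
  have ex d : expect mu (h d) + 2 * (\sum_i c d i ^+ 2) - tau d = - (#|S|%:R / 2 ^+ 23).
    have -> : \sum_i c d i ^+ 2 = #|S|%:R * (16 * lam) ^+ 2.
      rewrite -sum1_card natr_sum mulr_suml [RHS]big_mkcond /=.
      by apply: eq_bigr => i _; rewrite /c; case: (i \in S); rewrite ?mul1r ?mul0r ?expr0n.
    by rewrite /tau lamE; field.
  rewrite (eq_bigr (fun=> expR (- (#|S|%:R / 2 ^+ 23)))); last by move=> d _; rewrite ex.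
  rewrite sumr_const card_ord -[_ *+ P]mulr_natl.
  have h1 : P%:R * expR (- (#|S|%:R / 2 ^+ 23)) < 1 / 2 :> R.
    apply: le_lt_trans (pow2_expR_lt R k); apply: ler_pM => //.
    - exact: expR_ge0.
    - by rewrite -natrX ler_nat.
    - by rewrite ler_expR lerN2 ler_pdivlMr ?exprn_gt0 // mulrC.
  (* There are [125 * M ^ 3] forms, each of probability at most [4 / (1000 * M ^ 3)]. *)
  have h2 : \sum_b expect mu (fun w => (bad b w)%:R) <= 1 / 2.
    apply: le_trans (ler_sum _ (fun b _ => ebad b)) _.
    rewrite sumr_const !card_prod !card_ord -[_ *+ _]mulr_natl.
    have JRE : J%:R = 1000 * M%:R ^+ 3 :> R by rewrite JE natrM natrX.
    by rewrite mulrA ler_pdivrMr // JRE !natrM le_eqVlt; apply/orP; left; apply/eqP; field.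
  lra.
exists th; split.
  move=> b nz; have := hbad b; rewrite /bad nz /= -leNgt //.
move=> d Pd.
have dP : (d %% P < P)%N by rewrite ltn_mod.
have := hlow (Ordinal dP); rewrite /tau eh /=; last by rewrite /dvdn modn_mod.
rewrite -mulrDr /h -mulr_sumr ltr_pM2l // => /ltW hl.
have -> : \sum_(x in S) @triple_corr R (2 * pi * d%:R / P%:R * (th x)%:R)
    = \sum_x (x \in S)%:R * @triple_corr R (ang (d %% P)%N (th x)).
  rewrite big_mkcond; apply: eq_bigr => x _.
  case: (x \in S); rewrite ?mul0r // mul1r.
  rewrite -[RHS](triple_corrDnat2pi _ (d %/ P * th x)); congr triple_corr.
  rewrite /ang {1}(divn_eq d P) natrD !natrM; field; rewrite gt_eqF //.
by apply: le_trans hl _; lra.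
Qed.

End Frequencies.

(** * Sums along arithmetic progressions *)

Local Notation I53 := ('I_5 * 'I_5 * 'I_5)%type.

Section Fibres.

Variables (R : realType) (M : nat).
Hypothesis M0 : (0 < M)%N.

Let MR : 0 < M%:R :> R. Proof. by rewrite ltr0n. Qed.

Definition resid (n : nat) : 'I_M := Ordinal (ltn_pmod n M0).

Lemma residD n d : resid (resid n + d) = resid (n + d).
Proof. by apply: val_inj; rewrite /= modnDml. Qed.

Lemma residue_sum (x : 'I_M) V : exists Y : nat,
  [/\ (V <= M * Y + x)%N, (M * Y + x < V + M)%N &
  forall G : nat -> R, \sum_(0 <= n < V) (resid n == x)%:R * G n
     = \sum_(y < Y) G (x + y * M)%N].
Proof.
elim: V => [|V [Y [h1 h2 h3]]].
  by exists 0%N; split=> [||G]; rewrite ?muln0 ?big_geq ?big_ord0 // add0n.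
have E : (resid V == x) = (V == M * Y + x)%N.
  rewrite -val_eqE /=; apply/eqP/eqP => [xV|->]; last by rewrite mulnC modnMDl modn_small.
  have q := divn_eq V M; rewrite xV in q; move: (V %/ M)%N q => Q q.
  have QY : (Q * M <= Y * M)%N by move: h1; rewrite [(M * Y)%N]mulnC; lia.
  have YQ : (Y * M < Q.+1 * M)%N by move: h2; rewrite [(M * Y)%N]mulnC mulSn; lia.
  rewrite leq_pmul2r // in QY; rewrite ltn_pmul2r // ltnS in YQ.
  by rewrite q mulnC; congr (_ * _ + _)%N; apply/eqP; rewrite eqn_leq QY YQ.
have [VE|VN] := eqVneq V (M * Y + x)%N.
  exists Y.+1; split=> [||G]; rewrite ?mulnS; try by lia.
  by rewrite big_nat_recr //= big_ord_recr /= h3 E VE eqxx mul1r [(Y * M)%N]mulnC addnC [in RHS]addnC [(x + _)%N]addnC.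
exists Y; split=> [||G]; first by move: VN h1; lia.
  by lia.
by rewrite big_nat_recr //= h3 E (negPf VN) mul0r addr0.
Qed.

Lemma sum_nat_sub (G : nat -> R) u v : (u <= v)%N ->
  \sum_(u <= n < v) G n = \sum_(0 <= n < v) G n - \sum_(0 <= n < u) G n.
Proof. by move=> uv; rewrite (big_cat_nat (leq0n u) uv) /= addrAC subrr add0r. Qed.

Lemma residue_count (x : 'I_M) u v : (u <= v)%N ->
  `|\sum_(u <= n < v) (resid n == x)%:R - (v - u)%:R / M%:R| <= 1 :> R.
Proof.
move=> uv; rewrite sum_nat_sub //.
have [Y [h1 h2 h3]] := residue_sum x u; have [Z [g1 g2 g3]] := residue_sum x v.
have E V W : (forall G : nat -> R, \sum_(0 <= n < V) (resid n == x)%:R * G n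
     = \sum_(y < W) G (x + y * M)%N) -> \sum_(0 <= n < V) (resid n == x)%:R = W%:R :> R.
  move=> /(_ (fun=> 1)); rewrite sumr_const card_ord => <-.
  by apply: eq_bigr => n _; rewrite mulr1.
rewrite (E _ _ h3) (E _ _ g3) natrB //.
rewrite -(ler_pM2r MR) -{2}(gtr0_norm MR) -normrM mulrBl divfK ?gt_eqF //.
move: h1 (ltnW h2) g1 (ltnW g2); rewrite -!(ler_nat R) !natrD !natrM => {h2 g2} h1 h2 g1 g2.
by rewrite ler_norml; apply/andP; split; lra.
Qed.

Lemma residue_cos_bound (x : 'I_M) u v (phi h : R) : (u <= v)%N ->
  `|sin (h * M%:R / 2)| * `|\sum_(u <= n < v) (resid n == x)%:R * cos (phi + h * n%:R)|
    <= 2.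
Proof.
move=> uv; rewrite sum_nat_sub //.
have B V : `|sin (h * M%:R / 2)| * `|\sum_(0 <= n < V) (resid n == x)%:R * cos (phi + h * n%:R)|
    <= 1.
  have [Y [_ _ ->]] := residue_sum x V.
  apply: le_trans (cos_sum_bound (phi + h * x%:R) (h * M%:R) Y).
  rewrite ler_wpM2l // le_eqVlt; apply/orP; left; apply/eqP; congr `|_|.
  by apply: eq_bigr => y _; congr cos; rewrite natrD natrM; ring.
have := lerD (B v) (B u); rewrite -mulrDr => /le_trans H.
by apply: le_trans (H 2 _); rewrite ?ler_wpM2l ?ler_normB //; lra.
Qed.

Variable P : nat.
Hypothesis P0 : (0 < P)%N.

Definition unit_angle : R := 2 * pi / (M%:R * P%:R).

Definition fibre (a : 'I_M -> 'I_5 -> R) (th : 'I_M -> nat) (n : nat) : R :=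
  trigpoly (a (resid n)) (unit_angle * (th (resid n))%:R * n%:R).

Definition coef3 (a b c : 'I_M -> 'I_5 -> R) (d : nat) (x : 'I_M) (k : I53) : R :=
  a x k.1.1 * b (resid (x + d)) k.1.2 * c (resid (x + 2 * d)) k.2.

Definition freq3 (th : 'I_M -> nat) d (x : 'I_M) (k : I53) : int :=
  lin_form ((x, resid (x + d), resid (x + 2 * d)), (k.1.1, k.1.2, k.2)) th.

Definition phase3 (th : 'I_M -> nat) (d : nat) (x : 'I_M) (k : I53) : R :=
  unit_angle * ((freq k.1.2)%:~R * (th (resid (x + d)))%:R
     + 2 * (freq k.2)%:~R * (th (resid (x + 2 * d)))%:R) * d%:R.

(** The mean of the triple product over base points in the class [x]: terms of total frequency 0 do
    not depend on the base point and leave the cosine of the phase created by the shifts [d] and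
    [2 * d]. *)
Definition main_term a b c th d (x : 'I_M) : R :=
  \sum_(k : I53) coef3 a b c d x k * ((freq3 th d x k == 0)%:R * cos (phase3 th d x k)).

Lemma sum_pair3 (f : 'I_5 -> 'I_5 -> 'I_5 -> R) :
  \sum_i \sum_j \sum_k f i j k = \sum_(k : I53) f k.1.1 k.1.2 k.2.
Proof.
rewrite pair_bigA /= (eq_bigr (fun p : 'I_5 * 'I_5 => \sum_k (fun p k => f p.1 p.2 k) p k)) //.
by rewrite pair_bigA.
Qed.

Variables (a b c : 'I_M -> 'I_5 -> R) (th : 'I_M -> nat).
Hypothesis sa : forall x, symmetric_coef (a x).
Hypothesis sb : forall x, symmetric_coef (b x).
Hypothesis sc : forall x, symmetric_coef (c x).
Hypothesis a2 : forall x, \sum_k `|a x k| <= 2.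
Hypothesis b2 : forall x, \sum_k `|b x k| <= 2.
Hypothesis c2 : forall x, \sum_k `|c x k| <= 2.

Lemma fibre_prod d n :
  fibre a th n * fibre b th (n + d) * fibre c th (n + 2 * d)
  = \sum_x (resid n == x)%:R * \sum_k coef3 a b c d x k *
      cos (phase3 th d x k + unit_angle * (freq3 th d x k)%:~R * n%:R).
Proof.
rewrite (bigD1 (resid n)) //= eqxx mul1r [X in _ + X]big1 ?addr0; last first.
  by move=> x; rewrite eq_sym => /negPf ->; rewrite mul0r.
rewrite /fibre trigpoly_prod // sum_pair3; apply: eq_bigr => k _.
rewrite /coef3 /phase3 /freq3 !residD; congr (_ * cos _).
have E m : (m%:Z)%:~R = m%:R :> R by [].
rewrite /lin_form; move: (freq _) (freq _) (freq _) => f1 f2 f3.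
by rewrite !intrD !intrM !E (natrD _ n d) (natrD _ n (2 * d)) natrM; ring.
Qed.

Lemma sum_coef3_le d x : \sum_k `|coef3 a b c d x k| <= 8.
Proof.
rewrite (eq_bigr (fun k : I53 => `|a x k.1.1| * `|b (resid (x + d)) k.1.2|
   * `|c (resid (x + 2 * d)) k.2|)); last by move=> k _; rewrite !normrM.
rewrite -(sum_pair3 (fun i j k => `|a x i| * `|b (resid (x + d)) j|
   * `|c (resid (x + 2 * d)) k|)).
under eq_bigr do under eq_bigr do rewrite -mulr_sumr.
under eq_bigr do rewrite -mulr_suml -mulr_sumr.
rewrite -!mulr_suml.
have -> : 8 = 2 * 2 * 2 :> R by ring.
have nn (f : 'I_5 -> R) : 0 <= \sum_k `|f k| by apply: sumr_ge0.
by rewrite !ler_pM ?mulr_ge0.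
Qed.

Lemma main_term_le d x : `|main_term a b c th d x| <= 8.
Proof.
apply: le_trans (ler_norm_sum _ _ _) _; apply: le_trans (sum_coef3_le d x).
apply: ler_sum => k _; rewrite normrM ler_piMr //.
by case: eqP => _; rewrite ?mul0r ?mul1r ?normr0 ?cos_max.
Qed.

(* Frequencies that cancel identically give the main term; the other ones are
   bounded away from 0 and contribute bounded geometric sums. *)
Lemma fibre_sum_approx (eta : R) d u v : (u <= v)%N -> 0 < eta ->
  (forall x k, freq3 th d x k != 0 ->
     eta <= `|sin (pi * (freq3 th d x k)%:~R / P%:R)|) ->
  `|\sum_(u <= n < v) fibre a th n * fibre b th (n + d) * fibre c th (n + 2 * d)
     - (v - u)%:R / M%:R * \sum_x main_term a b c th d x| <= 8 * M%:R + 16 * M%:R / eta.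
Proof.
move=> uv eta0 good.
pose T x k : R := \sum_(u <= n < v) (resid n == x)%:R *
   cos (phase3 th d x k + unit_angle * (freq3 th d x k)%:~R * n%:R).
pose cnt x : R := \sum_(u <= n < v) (resid n == x)%:R.
have -> : \sum_(u <= n < v) fibre a th n * fibre b th (n + d) * fibre c th (n + 2 * d)
   = \sum_x \sum_k coef3 a b c d x k * T x k.
  under eq_bigr do rewrite fibre_prod.
  rewrite exchange_big /=; apply: eq_bigr => x _.
  under eq_bigr do rewrite mulr_sumr.
  rewrite exchange_big /=; apply: eq_bigr => k _.
  by rewrite mulr_sumr; apply: eq_bigr => n _; rewrite mulrCA.
have -> : \sum_x \sum_k coef3 a b c d x k * T x k - (v - u)%:R / M%:R * \sum_x main_term a b c th d x
   = \sum_x main_term a b c th d x * (cnt x - (v - u)%:R / M%:R)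
   + \sum_x \sum_k coef3 a b c d x k *
       (T x k - (freq3 th d x k == 0)%:R * cos (phase3 th d x k) * cnt x).
  rewrite mulr_sumr -sumrB -big_split; apply: eq_bigr => x _ /=.
  rewrite mulrBr [main_term _ _ _ _ _ _ * cnt x]mulr_suml.
  rewrite addrAC -big_split /= [in RHS]mulrC; congr (_ - _).
  by apply: eq_bigr => k _; ring.
apply: le_trans (ler_normD _ _) _; apply: lerD.
  apply: le_trans (ler_norm_sum _ _ _) _.
  have -> : 8 * M%:R = \sum_(x < M) 8 :> R by rewrite sumr_const card_ord -[RHS]mulr_natr.
  apply: ler_sum => x _; rewrite normrM -[leRHS]mulr1.
  by rewrite ler_pM ?main_term_le // residue_count.
apply: le_trans (ler_norm_sum _ _ _) _.
have -> : 16 * M%:R / eta = \sum_(x < M) 16 / eta :> R.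
  by rewrite sumr_const card_ord -[RHS]mulr_natr; ring.
apply: ler_sum => x _; apply: le_trans (ler_norm_sum _ _ _) _.
apply: le_trans (_ : \sum_k `|coef3 a b c d x k| * (2 / eta) <= _); last first.
  rewrite -mulr_suml.
  have -> : 16 / eta = 8 * (2 / eta) by ring.
  by rewrite ler_wpM2r ?sum_coef3_le // divr_ge0 // ltW.
apply: ler_sum => k _; rewrite normrM ler_wpM2l //.
have [f0|f0] := eqVneq (freq3 th d x k) 0.
  rewrite mul1r; suff -> : T x k = cos (phase3 th d x k) * cnt x.
    by rewrite subrr normr0 divr_ge0 // ltW.
  rewrite mulr_sumr; apply: eq_bigr => n _.
  by rewrite f0 mulr0 mul0r addr0 mulrC.
rewrite !mul0r subr0 ler_pdivlMr // mulrC.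
apply: le_trans (@residue_cos_bound x u v (phase3 th d x k) (unit_angle * (freq3 th d x k)%:~R) uv).
rewrite ler_wpM2r //; apply: le_trans (good x k f0) _.
rewrite le_eqVlt; apply/orP; left; apply/eqP; congr `|sin _|.
by rewrite /unit_angle; field; rewrite !pnatr_eq0 -!lt0n M0 P0.
Qed.

End Fibres.

(** * Refining the modulus *)

Definition mid : 'I_5 := Ordinal (isT : (2 < 5)%N).

Lemma freq_eq0 k : (freq k == 0) = (k == mid).
Proof. by rewrite /freq subr_eq0 -val_eqE. Qed.

(** Constants as trigonometric polynomials: unmodified fibres and the function 1 then fit the same
    format as modified fibres. *)
Definition const_coef (R : realType) (z : R) (k : 'I_5) : R := if k == mid then z else 0.

Lemma sum_const_coef (R : realType) (z : R) (f : 'I_5 -> R) :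
  \sum_k const_coef z k * f k = z * f mid.
Proof.
rewrite (bigD1 mid) //= big1 ?addr0 /const_coef ?eqxx // => k /negPf ->.
by rewrite mul0r.
Qed.

Lemma const_coef_sym (R : realType) (z : R) : symmetric_coef (const_coef z).
Proof.
move=> k; rewrite /const_coef -!val_eqE /=.
by case: k => [[|[|[|[|[|]]]]] h].
Qed.

Lemma trigpoly_const (R : realType) (z x : R) : trigpoly (const_coef z) x = z.
Proof. by rewrite /trigpoly sum_const_coef (eqP (_ : freq mid == 0)) ?mul0r ?cos0 ?mulr1. Qed.

Lemma sum_norm_const_coef (R : realType) (z : R) : \sum_k `|const_coef z k| = `|z|.
Proof.
rewrite -[RHS]mulr1 -(sum_const_coef `|z| (fun=> 1)); apply: eq_bigr => k _.
by rewrite /const_coef; case: eqP => _; rewrite ?mulr1 ?normr0.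
Qed.

Lemma trigpoly_amp_bounds (R : realType) (x : R) : 0 <= trigpoly (@amp R) x <= 2.
Proof.
have -> : trigpoly (@amp R) x = 1 + cos x / 2 - cos (2 * x) / 2.
  rewrite /trigpoly sum_ord5 !freq_inord // /amp !inordK //=.
  have -> : (0%:Z - 2)%:~R * x = - (2 * x) by rewrite /=; ring.
  have -> : (1%:Z - 2)%:~R * x = - x by ring.
  have -> : (2%:Z - 2)%:~R * x = 0 by ring.
  have -> : (3%:Z - 2)%:~R * x = x by ring.
  have -> : (4%:Z - 2)%:~R * x = 2 * x by ring.
  by rewrite !cosN cos0; field.
have := cos_geN1 x; have := cos_le1 x; have := cos_geN1 (2 * x); have := cos_le1 (2 * x).
by lra.
Qed.

(** If no other frequency triple cancels, fibres are seen only through their means. This covers both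
    generic distinct fibres and constant ones. *)
Lemma main_term_isolated (R : realType) M (M0 : (0 < M)%N) P
    (a b c : 'I_M -> 'I_5 -> R) th d (x : 'I_M) :
  (forall k : I53, k != (mid, mid, mid) -> coef3 M0 a b c d x k != 0 ->
     freq3 M0 th d x k != 0) ->
  main_term M0 P a b c th d x = a x mid * b (resid M0 (x + d)) mid * c (resid M0 (x + 2 * d)) mid.
Proof.
move=> iso; rewrite /main_term (bigD1 (mid, mid, mid)) // big1 ?addr0; last first.
  move=> k /iso; case: (eqVneq (coef3 _ _ _ _ _ _ _) 0) => [->|_ /(_ isT)].
    by rewrite mul0r.
  by move=> /negPf ->; rewrite mul0r mulr0.
have f0 : freq mid = 0 by [].
have -> : freq3 M0 th d x (mid, mid, mid) = 0 by rewrite /freq3 /lin_form /= f0 !mul0r.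
have -> : phase3 R M0 P th d x (mid, mid, mid) = 0.
  by rewrite /phase3 /= f0 !(mulr0, mul0r, addr0).
by rewrite eqxx cos0 !mulr1 /coef3 /= addr0.
Qed.

(* [kap] bounds both the excess of the third moment (in units of [beta ^ 3 / 64])
   and the proportion of points at which [F] has left its background value
   [beta]; each refinement step multiplies it by 1025. *)
Record state (R : realType) (eps beta kap : R) (M : nat) (F : nat -> R) : Prop := State {
  st_per : forall n, F (n %% M)%N = F n;
  st_ge0 : forall n, 0 <= F n;
  st_le2 : forall n, F n <= 2;
  st_sum : \sum_(n < M) F n = M%:R;
  st_low : forall d, ~~ (M %| d)%N ->
    \sum_(n < M) F n * F (n + d)%N * F (n + 2 * d)%N <= M%:R * (1 - eps);
  st_cube : \sum_(n < M) F n ^+ 3 <= M%:R * (1 - eps + kap * beta ^+ 3 / 64);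
  st_bg : M%:R * (1 - kap) <= #|[set x : 'I_M | F x == beta]|%:R }.

Section Step.

Variables (R : realType) (eps beta kap : R) (M : nat) (F : nat -> R).
Hypothesis oddM : odd M.
Hypothesis stF : state eps beta kap M F.
Hypothesis beta0 : 0 < beta.
Hypothesis beta1 : beta <= 1.

Hypothesis M0 : (0 < M)%N.

(** Replacing [beta] by [beta] times a profile of mean 1 keeps every fibre mean, so differences not
    divisible by [M] see the old [F]. For the other differences the saving [#|S| * beta ^+ 3 / 64]
    outweighs the excess recorded in [st_cube]. *)
Lemma step_function (S : {set 'I_M}) (e k : nat) :
  (forall x, x \in S -> F x = beta) -> kap * M%:R <= #|S|%:R ->
  (1000 * M ^ 3 <= 7 ^ e)%N -> (7 ^ e <= 2 ^ k)%N -> 2 ^+ 23 * k.+1%:R <= #|S|%:R :> R ->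
  exists G : nat -> R,
   [/\ forall n, G (n %% (M * 7 ^ e))%N = G n,
       forall n, resid M0 n \notin S -> G n = F n,
       forall n, resid M0 n \in S -> 0 <= G n <= 2 * beta,
       forall d u v, ~~ (M * 7 ^ e %| d)%N -> (u <= v)%N ->
         \sum_(u <= n < v) G n * G (n + d)%N * G (n + 2 * d)%N
           <= (v - u)%:R * (1 - eps) + 2 ^+ 15 * M%:R ^+ 4 &
       forall u v, (u <= v)%N ->
         `|\sum_(u <= n < v) G n - (v - u)%:R| <= 2 ^+ 15 * M%:R ^+ 4].
Proof.
move=> SB kS JP P2k mk.
have [th [th1 th2]] := @exists_frequencies R M e k _ S M0 erefl JP P2k mk.
set P := (7 ^ e)%N in JP P2k th th1 th2 *.
have P0 : (0 < P)%N by rewrite expn_gt0.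
have PR : 0 < P%:R :> R by rewrite ltr0n.
have MR : 0 < M%:R :> R by rewrite ltr0n.
have MR1 : 1 <= M%:R :> R by rewrite ler1n.
pose thn x : nat := th x.
pose a x := if x \in S then (fun k => beta * amp R k) else const_coef (F x).
pose one (_ : 'I_M) : 'I_5 -> R := const_coef 1.
have sa x : symmetric_coef (a x).
  rewrite /a; case: (x \in S); last exact: const_coef_sym.
  by move=> i; rewrite amp_sym.
have sone x : symmetric_coef (one x) by exact: const_coef_sym.
have a2 x : \sum_k `|a x k| <= 2.
  rewrite /a; case: (x \in S).
    under eq_bigr do rewrite normrM.
    by rewrite -mulr_sumr sum_norm_amp (gtr0_norm beta0) ler_piMl.
  by rewrite sum_norm_const_coef ger0_norm ?(st_ge0 stF) ?(st_le2 stF).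
have one2 x : \sum_k `|one x k| <= 2.
  by rewrite sum_norm_const_coef normr1 ler1n.
have amid x : a x mid = F x.
  rewrite /a; case: ifP => [/SB ->|_]; last by rewrite /const_coef eqxx.
  by rewrite /amp /= mulr1.
set J := (1000 * M ^ 3)%N in th1.
pose eta : R := (2 * J%:R)^-1.
have J0 : (0 < J)%N by rewrite muln_gt0 expn_gt0 M0.
have eta0 : 0 < eta by rewrite invr_gt0 mulr_gt0 // ltr0n.
have nzf b : [exists y, lin_coef b y != 0] -> lin_form b thn != 0.
  move=> /th1; apply: contraTneq => ->.
  by rewrite mulr0 mul0r sin0 normr0 -ltNge.
have good d x q : freq3 M0 thn d x q != 0 ->
    eta <= `|sin (pi * (freq3 M0 thn d x q)%:~R / P%:R)|.
  move=> f0; apply: th1; apply: contraTT f0; rewrite negb_exists => /forallP z.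
  by rewrite negbK /freq3 lin_formE big1 // => y _; move: (z y); rewrite negbK => /eqP ->; rewrite mul0r.
(* Since [1 / eta = 2000 * M ^ 3], the second term is [32000 * M ^ 4], and [2 ^ 15 = 32768] leaves
   room for the first. *)
have err : 8 * M%:R + 16 * M%:R / eta <= 2 ^+ 15 * M%:R ^+ 4 :> R.
  have -> : 16 * M%:R / eta = 32 * 1000 * M%:R ^+ 4 :> R.
    by rewrite /eta invrK /J natrM natrX; ring.
  have : M%:R <= M%:R ^+ 4 :> R by rewrite ler_eXnr.
  by have := MR; lra.
pose G := fibre M0 P a thn.
have GnS n : resid M0 n \notin S -> G n = F n.
  by move=> nS; rewrite /G /fibre /a (negPf nS) trigpoly_const /= (st_per stF).
have GS n : resid M0 n \in S -> 0 <= G n <= 2 * beta.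
  move=> nS; rewrite /G /fibre /a nS.
  set A := unit_angle _ _ _ * _ * _.
  have -> : trigpoly (fun k => beta * amp R k) A = beta * trigpoly (@amp R) A.
    by rewrite /trigpoly mulr_sumr; apply: eq_bigr => i _; rewrite mulrA.
  have /andP[t0 t2] := trigpoly_amp_bounds A.
  by rewrite mulr_ge0 ?(ltW beta0) //= mulrC ler_pM2r.
exists G; split=> //.
- move=> n; rewrite /G /fibre.
  have -> : resid M0 (n %% (M * P)) = resid M0 n.
    by apply: val_inj; rewrite /= modn_dvdm // dvdn_mulr.
  apply: eq_bigr => i _; congr (_ * _).
  rewrite -[LHS](cosDint2pi _ (freq i * (thn (resid M0 n))%:Z * (n %/ (M * P))%:Z)).
  congr cos.
  have -> : n%:R = (n %/ (M * P))%:R * (M%:R * P%:R) + (n %% (M * P))%:R :> R.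
    by rewrite -!natrM -natrD -divn_eq.
  have E m : (m%:Z)%:~R = m%:R :> R by [].
  rewrite /unit_angle !intrM !E; field.
  by rewrite !pnatr_eq0 -!lt0n M0 P0.
- move=> d u v Pd uv.
  have := fibre_sum_approx (M0 := M0) P0 sa sa sa a2 a2 a2 uv eta0 (good d).
  rewrite -/G ler_norml => /andP[_]; rewrite lerBlDl => /le_trans; apply.
  apply: lerD => //; rewrite -mulrA ler_wpM2l // mulrC ler_pdivrMr // mulrC.
  (* When [M] does not divide [d], the three residues are distinct (the first and third because [M]
     is odd), so any nonconstant frequency triple gives a nontrivial form and cannot cancel. *)
  have [Md|Md] := boolP (M %| d)%N; last first.
    apply: le_trans (st_low stF Md); apply: ler_sum => x _.
    rewrite main_term_isolated ?amid ?(st_per stF) //= => q knm _; apply: nzf.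
    have n12 : (resid M0 (x + d) == x) = false.
      apply: contraNF Md => /eqP /(congr1 val) /= E.
      by rewrite /dvdn -[X in _ == X](mod0n M) -(eqn_modDl x) addn0 E modn_small.
    have n13 : (resid M0 (x + 2 * d) == x) = false.
      apply: contraNF Md => /eqP /(congr1 val) /= E.
      rewrite -(@Gauss_dvdr M 2) ?coprimen2 //.
      by rewrite /dvdn -[X in _ == X](mod0n M) -(eqn_modDl x) addn0 E modn_small.
    have n23 : (resid M0 (x + 2 * d) == resid M0 (x + d)) = false.
      apply: contraNF Md => /eqP /(congr1 val) /= /eqP.
      by rewrite mul2n -addnn addnA -[X in _ == X %[mod _]]addn0 eqn_modDl mod0n.
    case: q knm => [[k1 k2] k3] /=.
    have [->|k1n _] := eqVneq k1 mid; last first.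
      apply/existsP; exists x; rewrite /lin_coef eqxx n12 n13 !mul0r !addr0 mul1r.
      by rewrite freq_eq0.
    have [->|k2n _] := eqVneq k2 mid; last first.
      apply/existsP; exists (resid M0 (x + d)).
      rewrite /lin_coef eqxx n23 [x == _]eq_sym n12 !mul0r add0r addr0 mul1r.
      by rewrite freq_eq0.
    have [->|k3n _] := eqVneq k3 mid; first by rewrite eqxx.
    apply/existsP; exists (resid M0 (x + 2 * d)).
    rewrite /lin_coef eqxx [x == _]eq_sym n13 [resid M0 (x + d) == _]eq_sym n23 !mul0r !add0r mul1r.
    by rewrite freq_eq0.
  (* Now all three terms lie in one fibre, and the correlation is that of the profile with itself at
     difference [d'] modulo [P]. *)
  have [d' dE] := dvdnP Md.
  have Pd' : ~~ (P %| d')%N by move: Pd; rewrite dE mulnC dvdn_pmul2r.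
  have r2 (x : 'I_M) : resid M0 (x + d) = x.
    by apply: val_inj; rewrite /= dE addnC modnMDl modn_small.
  have r3 (x : 'I_M) : resid M0 (x + 2 * d) = x.
    by apply: val_inj; rewrite /= dE mulnA addnC modnMDl modn_small.
  have mainE x : main_term M0 P a a a thn d x
     = if x \in S then beta ^+ 3 * triple_corr (2 * pi * d'%:R / P%:R * (th x)%:R)
       else F x ^+ 3.
    case: ifPn => xS; last first.
      rewrite main_term_isolated ?amid ?r2 ?r3 ?amid; first by rewrite !exprS mulr1 mulrA.
      move=> [[k1 k2] k3] kn; rewrite /coef3 /= r2 r3 /a (negPf xS) /const_coef.
      move: kn; rewrite !xpair_eqE.
      by do 3 (case: eqP => _ /=; rewrite ?(mul0r, mulr0) ?eqxx //).
    rewrite /main_term /triple_corr sum_pair3 mulr_sumr; apply: eq_bigr => -[[k1 k2] k3] _.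
    rewrite /coef3 /freq3 /phase3 /= r2 r3 /a xS.
    have -> : (lin_form (x, x, x, (k1, k2, k3)) thn == 0) = (freq k1 + freq k2 + freq k3 == 0).
      apply/eqP/eqP => [|f0]; last by rewrite /lin_form -!mulrDl f0 mul0r.
      apply: contra_eq => f0; apply: nzf; apply/existsP; exists x.
      by rewrite /lin_coef eqxx !mul1r.
    have -> : unit_angle R M P * ((freq k2)%:~R * (thn x)%:R + 2 * (freq k3)%:~R * (thn x)%:R) * d%:R
        = (freq k2 + 2 * freq k3)%:~R * (2 * pi * d'%:R / P%:R * (th x)%:R).
      rewrite intrD intrM dE natrM /unit_angle /thn; field.
      by rewrite !pnatr_eq0 -!lt0n M0 P0.
    by ring.
  under eq_bigr do rewrite mainE.
  rewrite (bigID (mem S)) /=.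
  rewrite (eq_bigr (fun x : 'I_M => beta ^+ 3 * triple_corr (2 * pi * d'%:R / P%:R * (th x)%:R)));
    last by move=> x ->.
  rewrite [X in _ + X](eq_bigr (fun x : 'I_M => F x ^+ 3)); last by move=> x /negPf ->.
  have := st_cube stF; rewrite (bigID (mem S)) /=.
  rewrite (eq_bigr (fun=> beta ^+ 3)); last by move=> x /SB ->.
  rewrite sumr_const -[beta ^+ 3 *+ _]mulr_natl -mulr_sumr.
  have b3 : 0 < beta ^+ 3 by rewrite exprn_gt0.
  have kSb : kap * M%:R * beta ^+ 3 <= #|S|%:R * beta ^+ 3 by rewrite ler_pM2r.
  have := th2 d' Pd'; rewrite -(ler_pM2l b3).
  by lra.
- move=> u v uv.
  (* The plain sum of [G] is a triple sum with the constant 1 in two slots and [d = 0]. *)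
  have := fibre_sum_approx (M0 := M0) P0 sa sone sone a2 one2 one2 uv eta0 (good 0%N).
  have -> : \sum_x main_term M0 P a one one thn 0 x = M%:R.
    rewrite -(st_sum stF); apply: eq_bigr => x _.
    rewrite main_term_isolated; first by rewrite amid /one /const_coef eqxx !mulr1.
    move=> [[k1 k2] k3] kn; rewrite /coef3 /= /one /const_coef.
    have [k2E|_] := eqVneq k2 mid; last by rewrite mulr0 mul0r eqxx.
    have [k3E|_] := eqVneq k3 mid; last by rewrite mulr0 eqxx.
    move=> _; apply: nzf; apply/existsP; exists x; rewrite /lin_coef eqxx /= k2E k3E.
    have -> : freq mid = 0 by [].
    by rewrite !mulr0 !addr0 mul1r freq_eq0; move: kn; rewrite k2E k3E !xpair_eqE !eqxx !andbT.
  rewrite divfK ?gt_eqF // (eq_bigr G); last first.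
    by move=> n _; rewrite /fibre !trigpoly_const !mulr1.
  by move=> /le_trans; apply.
Qed.

End Step.

(** * Exact cyclic inequalities, and the passage from one state to the next *)

Lemma periodic_sum_mul (V : nmodType) (g : nat -> V) Q m :
  (forall n, g (n %% Q)%N = g n) ->
  \sum_(0 <= n < m * Q) g n = (\sum_(n < Q) g n) *+ m.
Proof.
move=> gQ; elim: m => [|m IH]; first by rewrite mul0n big_geq // mulr0n.
rewrite mulSn addnC (big_cat_nat (leq0n (m * Q)) (leq_addr _ _)) /= IH mulrSr; congr (_ + _).
rewrite -{1}[(m * Q)%N]add0n big_addn addKn big_mkord.
by apply: eq_bigr => i _; rewrite -gQ addnC modnMDl gQ.
Qed.

(** Over [m] periods a violation would grow linearly in [m] while the error [B] stays fixed. *)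
Lemma periodic_sum_le (R : realType) (g : nat -> R) Q mu B :
  (forall n, g (n %% Q)%N = g n) ->
  (forall v, \sum_(0 <= n < v) g n <= v%:R * mu + B) ->
  \sum_(n < Q) g n <= Q%:R * mu.
Proof.
move=> gQ gB; rewrite leNgt; apply/negP => lt; set S := \sum_(n < Q) g n in lt *.
have d0 : 0 < S - Q%:R * mu by rewrite subr_gt0.
have B0 : 0 <= B by have := gB 0%N; rewrite big_geq // mul0r add0r.
have [m mB] : exists m : nat, B / (S - Q%:R * mu) < m%:R.
  by exists (Num.bound (B / (S - Q%:R * mu))); rewrite archi_boundP // divr_ge0 // ltW.
have := gB (m * Q)%N; rewrite periodic_sum_mul // -/S -mulr_natl natrM.
by move: mB; rewrite ltr_pdivrMr //; lra.
Qed.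

Lemma exists_subset_card (T : finType) (B : {set T}) m : (m <= #|B|)%N ->
  exists2 S : {set T}, S \subset B & #|S| = m.
Proof.
move=> mB; exists [set x in take m (enum B)].
  by apply/subsetP => x; rewrite inE => /mem_take; rewrite mem_enum.
rewrite cardsE (card_uniqP _) ?take_uniq ?enum_uniq //.
by rewrite size_takel // -cardE.
Qed.

Lemma exists_nat_ceil (R : realType) (x : R) : 0 <= x -> exists m : nat, x <= m%:R <= x + 1.
Proof.
move=> x0; exists (Num.truncn x).+1; have /andP[] := truncn_itv x0.
by rewrite -natr1 => a /ltW ->; rewrite lerD2r.
Qed.

Lemma natr_card_set (R : realType) (T : finType) (p : pred T) :
  #|[set x | p x]|%:R = \sum_x (p x)%:R :> R.
Proof.
rewrite -sum1_card natr_sum big_mkcond /=; apply: eq_bigr => x _.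
by rewrite inE; case: (p x).
Qed.

Lemma state_le (R : realType) (eps beta kap kap' : R) M F : 0 <= beta -> kap <= kap' ->
  state eps beta kap M F -> state eps beta kap' M F.
Proof.
move=> b0 kk [p g0 l2 s l c b]; split=> //.
  apply: le_trans c _; apply: ler_wpM2l => //; rewrite lerD2l.
  by rewrite ler_pM2r ?invr_gt0 // ler_wpM2r // exprn_ge0.
by apply: le_trans b; apply: ler_wpM2l => //; rewrite lerD2l lerN2.
Qed.

(** The factor is [1025 = 1 + 1024]: at most [kap * M + 1 <= 2 * kap * M] fibres are changed, and
    each has cubes at most [8 * beta ^+ 3], which adds [16 * kap = 1024 * kap / 64]. The bound
    [3 * kap <= 1] ensures that enough flat fibres remain to choose from. *)
Lemma state_step (R : realType) (eps beta kap : R) (M : nat) (F : nat -> R) e k :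
  odd M -> 0 < beta <= 1 -> state eps beta kap M F ->
  1 <= kap * M%:R -> 3 * kap <= 1 ->
  (1000 * M ^ 3 <= 7 ^ e)%N -> (7 ^ e <= 2 ^ k)%N -> 2 ^+ 23 * k.+1%:R <= kap * M%:R ->
  exists G : nat -> R,
   [/\ state eps beta (1025 * kap) (M * 7 ^ e) G,
       forall d u v, ~~ (M * 7 ^ e %| d)%N -> (u <= v)%N ->
         \sum_(u <= n < v) G n * G (n + d)%N * G (n + 2 * d)%N
           <= (v - u)%:R * (1 - eps) + 2 ^+ 15 * M%:R ^+ 4 &
       forall u v, (u <= v)%N ->
         `|\sum_(u <= n < v) G n - (v - u)%:R| <= 2 ^+ 15 * M%:R ^+ 4].
Proof.
move=> oddM /andP[b0 b1] stF kM k3 JP P2k mk.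
have M0 : (0 < M)%N by exact: odd_gt0.
have MR : 0 < M%:R :> R by rewrite ltr0n.
have kap0 : 0 < kap by rewrite -(pmulr_lgt0 _ MR); lra.
have [m /andP[km mk1]] := @exists_nat_ceil R (kap * M%:R) (ltW (mulr_gt0 kap0 MR)).
set B := [set x : 'I_M | F x == beta].
have mB : (m <= #|B|)%N.
  rewrite -(ler_nat R); apply: le_trans (st_bg stF).
  have : 3 * kap * M%:R <= 1 * M%:R by rewrite ler_pM2r.
  by lra.
have [S SB Sm] := exists_subset_card mB.
have SF x : x \in S -> F x = beta by move=> /(subsetP SB); rewrite inE => /eqP.
have kS : kap * M%:R <= #|S|%:R by rewrite Sm.
have mkS : 2 ^+ 23 * k.+1%:R <= #|S|%:R :> R by apply: le_trans kS.
have [G [Gper GnS GS Glow Gmean]] := step_function oddM stF b0 b1 M0 SF kS JP P2k mkS.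
set P := (7 ^ e)%N in JP P2k Gper Glow *.
have P0 : (0 < P)%N by rewrite expn_gt0.
have PR : 0 < P%:R :> R by rewrite ltr0n.
pose inS n := (resid M0 n \in S).
have perS (n : nat) : inS (n %% M)%N = inS n.
  by congr (_ \in S); apply: val_inj; rewrite /= modn_mod.
have sumS : \sum_(n < M) (inS n)%:R = #|S|%:R :> R.
  rewrite -sum1_card natr_sum [RHS]big_mkcond; apply: eq_bigr => x _; rewrite /inS.
  have -> : resid M0 x = x by apply: val_inj; rewrite /= modn_small.
  by case: (x \in S).
have sumP (h : nat -> R) : (forall n, h (n %% M)%N = h n) ->
    \sum_(n < M * P) h n = P%:R * \sum_(n < M) h n.
  by move=> hM; rewrite -(big_mkord predT) mulnC periodic_sum_mul // mulr_natl.
have G02 n : 0 <= G n <= 2.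
  have [nS|nS] := boolP (resid M0 n \in S).
    by have /andP[-> /le_trans->//] := GS n nS; lra.
  by rewrite GnS // (st_ge0 stF) (st_le2 stF).
exists G; split=> //; split.
- exact: Gper.
- by move=> n; have /andP[] := G02 n.
- by move=> n; have /andP[] := G02 n.
- apply: le_anti; apply/andP; split.
    rewrite -[leRHS]mulr1; apply: (periodic_sum_le (B := 2 ^+ 15 * M%:R ^+ 4) Gper) => v.
    by have := Gmean 0%N v (leq0n v); rewrite subn0 ler_norml mulr1 => /andP[_]; lra.
  rewrite -lerN2 -sumrN -mulrN1.
  apply: (@periodic_sum_le R (fun n => - G n) (M * P) (-1) (2 ^+ 15 * M%:R ^+ 4)) => [n|v].
    by rewrite Gper.
  have := Gmean 0%N v (leq0n v); rewrite subn0 ler_norml sumrN => /andP[]; lra.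
- move=> d Pd.
  apply: (@periodic_sum_le R (fun n => G n * G (n + d)%N * G (n + 2 * d)%N) _ _
     (2 ^+ 15 * M%:R ^+ 4)) => [n|v].
    by rewrite Gper -[G (_ + d)%N]Gper -[G (_ + 2 * d)%N]Gper !modnDml !Gper.
  by have := Glow d 0%N v Pd (leq0n v); rewrite subn0.
- apply: le_trans (_ : \sum_(n < M * P) (F n ^+ 3 + (inS n)%:R * (8 * beta ^+ 3)) <= _).
    apply: ler_sum => n _; rewrite /inS.
    have [nS|nS] := boolP (resid M0 n \in S); last by rewrite mul0r addr0 GnS.
    have /andP[g0 g1] := GS n nS.
    rewrite mul1r; apply: le_trans (_ : (2 * beta) ^+ 3 <= _).
      by rewrite lerXn2r ?nnegrE //; lra.
    have -> : (2 * beta) ^+ 3 = 8 * beta ^+ 3 by ring.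
    by rewrite lerDr exprn_ge0 ?(st_ge0 stF).
  rewrite (sumP (fun n => F n ^+ 3 + (inS n)%:R * (8 * beta ^+ 3))); last first.
    by move=> n; rewrite (st_per stF) perS.
  rewrite big_split /= -mulr_suml sumS natrM -[leRHS]mulrA [leRHS]mulrCA ler_pM2l //.
  have := st_cube stF; rewrite Sm.
  have b3 : 0 < beta ^+ 3 by rewrite exprn_gt0.
  have : m%:R * beta ^+ 3 <= 2 * kap * M%:R * beta ^+ 3 by rewrite ler_pM2r //; lra.
  by lra.
- rewrite natr_card_set.
  apply: le_trans (_ : \sum_(n < M * P) ((F n == beta)%:R - (inS n)%:R) <= _); last first.
    apply: ler_sum => n _; rewrite /inS.
    have [nS|nS] := boolP (resid M0 n \in S); last by rewrite subr0 GnS.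
    by case: (F n == beta); case: (G n == beta); rewrite /= ?subrr ?sub0r ?lerN10 ?ler01 //; lra.
  rewrite (sumP (fun n => (F n == beta)%:R - (inS n)%:R)); last first.
    by move=> n; rewrite (st_per stF) perS.
  rewrite sumrB sumS -natr_card_set natrM -[leLHS]mulrA [leLHS]mulrCA ler_pM2l //.
  have := st_bg stF; rewrite Sm => h.
  have : 0 < kap * M%:R by rewrite mulr_gt0.
  rewrite -/B in h *; lra.
Qed.

Lemma periodic_sum_shift (V : zmodType) (g : nat -> V) Q c :
  (forall n, g (n %% Q)%N = g n) ->
  \sum_(n < Q) g (n + c)%N = \sum_(n < Q) g n.
Proof.
move=> gQ; elim: c => [|c IH]; first by apply: eq_bigr => n _; rewrite addn0.
rewrite -IH; apply: (addrI (g c)).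
transitivity (\sum_(n < Q.+1) g (n + c)%N).
  rewrite big_ord_recl add0n; congr (_ + _); apply: eq_bigr => n _.
  by rewrite /= /bump addnS.
by rewrite big_ord_recr /= addrC -[g (Q + c)%N]gQ modnDl gQ.
Qed.

(** With [b = 1 - 1 / M] and a unit mass at the multiples of [M = r ^ 2], no progression of nonzero
    difference meets the mass twice, so its mean is [b ^ 3 + 3 * b ^ 2 / M = 1 - 3 / M ^ 2 + 2 / M ^
    3], at most [1 - 1 / M ^ 2]. The true excess has order [1 / M]; the larger [kap = 1 / r] is
    taken so that [kap * M = r] fibres are available for the first refinement. *)
Lemma state_base (R : realType) (r : nat) : (2 ^ 12 <= r)%N ->
  odd r ->
  state (1 / r%:R ^+ 4 : R) (1 - 1 / r%:R ^+ 2) (1 / r%:R) (r ^ 2)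
    (fun n => 1 - 1 / r%:R ^+ 2 + (r ^ 2 %| n)%N%:R).
Proof.
move=> r12 oddr; set M := (r ^ 2)%N; set b : R := 1 - 1 / r%:R ^+ 2.
have r0 : (0 < r)%N by apply: leq_trans r12.
have M0 : (0 < M)%N by rewrite expn_gt0 r0.
have rR : 2 ^+ 12 <= r%:R :> R by rewrite -natrX ler_nat.
have rR0 : 0 < r%:R :> R by apply: lt_le_trans rR; rewrite exprn_gt0.
have ME : M%:R = r%:R ^+ 2 :> R by rewrite natrX.
have oddM : odd M by rewrite oddX oddr.
have MR0 : 0 < M%:R :> R by rewrite ltr0n.
pose z n : R := (M %| n)%N%:R.
have zper n : z (n %% M)%N = z n by rewrite /z /dvdn modn_mod.
have zsum c : \sum_(n < M) z (n + c)%N = 1.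
  rewrite periodic_sum_shift //.
  rewrite (bigD1 (Ordinal M0)) //= big1 ?addr0 /z ?dvdn0 // => i.
  by rewrite -val_eqE /= => i0; rewrite gtnNdvd // lt0n.
have bE : b = 1 - 1 / M%:R by rewrite /b ME.
have M16 : 2 ^+ 24 <= M%:R :> R.
  by rewrite ME (exprM _ 12 2) lerXn2r ?nnegrE ?exprn_ge0 // ltW.
have M2 : 2 <= M%:R :> R by apply: le_trans M16; rewrite ler_eXnr // ler1n.
have b12 : 1 / 2 <= b.
  have : 1 / M%:R <= 1 / 2 :> R by rewrite ler_pdivrMr //; lra.
  by rewrite bE; lra.
have b1 : b <= 1 by rewrite bE gerBl divr_ge0 // ltW.
split.
- by move=> n; rewrite -/(z n) -/(z (n %% M)%N) zper.
- by move=> n; rewrite addr_ge0 //; lra.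
- by move=> n; case: (_ %| _)%N => /=; lra.
- rewrite big_split /= sumr_const card_ord -[b *+ _]mulr_natl.
  have -> : \sum_(n < M) (M %| n)%N%:R = 1 :> R.
    by rewrite -[RHS](zsum 0%N); apply: eq_bigr => n _; rewrite addn0.
  by rewrite bE; field; rewrite gt_eqF.
- move=> d Md.
  have zz n c : (~~ (M %| c))%N -> z n * z (n + c)%N = 0.
    move=> Mc; rewrite /z; case: (boolP (M %| n)%N) => [Mn|_]; last by rewrite mul0r.
    by rewrite dvdn_addr // (negPf Mc) mulr0.
  have M2d : ~~ (M %| 2 * d)%N by rewrite Gauss_dvdr // coprimen2.
  rewrite (eq_bigr (fun n : 'I_M => b ^+ 3 + b ^+ 2 * (z (n + 0)%N + z (n + d)%N + z (n + 2 * d)%N))).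
    rewrite big_split /= sumr_const card_ord -[_ *+ _]mulr_natl -mulr_sumr !big_split /= !zsum.
    have -> : 1 / r%:R ^+ 4 = (1 / M%:R) ^+ 2 :> R.
      by rewrite ME; field; rewrite gt_eqF.
    have -> : M%:R * b ^+ 3 + b ^+ 2 * (1 + 1 + 1)
      = M%:R * (1 - (1 / M%:R) ^+ 2 - 2 * ((1 / M%:R) ^+ 2 * (1 - 1 / M%:R))).
      by rewrite bE; field; rewrite gt_eqF.
    rewrite ler_pM2l // gerBl mulr_ge0 // mulr_ge0 ?sqr_ge0 //.
    by rewrite -bE; lra.
  move=> n _; rewrite -!/(z _) addn0.
  have z1 := zz n d Md; have z2 := zz n (2 * d)%N M2d.
  have z3 : z (n + d)%N * z (n + 2 * d)%N = 0 by rewrite mul2n -addnn addnA zz.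
  move: (z n) (z (n + d)%N) (z (n + 2 * d)%N) z1 z2 z3 => p q s pq ps qs.
  transitivity (b ^+ 3 + b ^+ 2 * (p + q + s) + b * (p * q + p * s + q * s) + (p * q) * s).
    by ring.
  by rewrite pq ps qs; ring.
- apply: le_trans (_ : \sum_(n < M) (1 + 7 * z (n + 0)%N) <= _).
    apply: ler_sum => n _; rewrite -/(z n) addn0 /z; case: (M %| n)%N => /=.
      rewrite mulr1; apply: le_trans (_ : (1 + 1) ^+ 3 <= _); last by lra.
      by rewrite lerXn2r ?nnegrE //; lra.
    rewrite addr0 mulr0 addr0 -(expr1n _ 3) lerXn2r ?nnegrE //; lra.
  rewrite big_split /= -mulr_sumr zsum sumr_const card_ord mulr1.
  have -> : 1 / r%:R ^+ 4 = 1 / M%:R ^+ 2 :> R.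
    by rewrite ME; field; rewrite gt_eqF.
  have b3 : 1 / 8 <= b ^+ 3.
    have -> : 1 / 8 = (1 / 2) ^+ 3 :> R by field.
    by rewrite lerXn2r ?nnegrE //; lra.
  have -> : M%:R * (1 - 1 / M%:R ^+ 2 + 1 / r%:R * b ^+ 3 / 64)
     = M%:R - 1 / M%:R + r%:R * b ^+ 3 / 64.
     by rewrite ME; field; rewrite gt_eqF.
  have : 1 / M%:R <= 1 :> R by rewrite ler_pdivrMr //; lra.
  (* This gives [r * b ^+ 3 / 64 >= 8], which covers the 7 from the cube [2 ^ 3 = 1 + 7] at the mass
     and the term [1 / M <= 1]. *)
  have : 2 ^+ 12 * (1 / 8) <= r%:R * b ^+ 3 by rewrite ler_pM ?exprn_ge0 ?divr_ge0.
  by lra.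
- rewrite natr_card_set.
  apply: le_trans (_ : \sum_(n < M) (1 - z (n + 0)%N) <= _).
    rewrite sumrB zsum sumr_const card_ord ME.
    have -> : r%:R ^+ 2 * (1 - 1 / r%:R) = r%:R ^+ 2 - r%:R :> R by field; rewrite gt_eqF.
    by lra.
  apply: ler_sum => n _; rewrite addn0 /z; case: (M %| n)%N; first by rewrite subrr.
  by rewrite addr0 eqxx subr0.
Qed.

(** * Iteration *)

Lemma expn_dominates p : exists n0, forall n, (n0 <= n)%N -> (n ^ p <= 2 ^ n)%N.
Proof.
have [->|p0] := posnP p; first by exists 0%N => n _; rewrite expn0 expn_gt0.
exists ((2 * p) ^ 2)%N => n hn; set q := (n %/ (2 * p))%N.
have p2 : (0 < 2 * p)%N by rewrite muln_gt0.
have nq : (n < 2 * p * q.+1)%N by rewrite mulnC ltn_ceil.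
have pq : (2 * p <= q)%N by rewrite leq_divRL // -expnS mulnn.
apply: (@leq_trans (q.+1 ^ (2 * p))).
  rewrite expnM leq_exp2r //; apply: leq_trans (ltnW nq) _.
  by rewrite expnS expn1 leq_mul2r (leq_trans pq).
apply: (@leq_trans ((2 ^ q) ^ (2 * p))); first by rewrite leq_exp2r // ltn_expl.
by rewrite -expnM leq_exp2l // leq_trunc_div.
Qed.

Lemma exists_pow_between p X : (1 < p)%N -> (0 < X)%N -> exists e, (X <= p ^ e < p * X)%N.
Proof.
move=> p1 X0; exists (up_log p X); rewrite up_logP //=.
have [X1|X1] := leqP X 1.
  have -> : X = 1%N by lia.
  by rewrite up_log1 expn0 muln1.
have /andP[] := up_log_bounds p1 X1.
rewrite -(ltn_pmul2l (ltnW p1)) -expnS prednK //.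
by rewrite up_log_gt0 p1.
Qed.

Lemma pow_mul_pow2_le r p T : (r ^ p * 2 ^ T <= 2 ^ (T + p * r))%N.
Proof.
elim: p => [|p IH]; first by rewrite mul1n addn0.
rewrite expnS -mulnA mulSn addnCA expnD leq_mul //.
by rewrite ltnW // ltn_expl.
Qed.

Lemma lin_lt_quad r T : (0 < T)%N -> (303 <= r)%N -> (T + 301 * r < r ^ 2 * T)%N.
Proof.
move=> T0 r0; apply: (@leq_trans ((1 + 302 * r) * T)); first by nia.
by rewrite -mulnn leq_mul2r; apply/orP; right; nia.
Qed.

Lemma tower_gt0 i : (0 < tower i)%N.
Proof. by case: i => //= i; rewrite expn_gt0. Qed.

Section Scale.

Variables (r D : nat).
Hypothesis r24 : (2 ^ 24 <= r)%N.
Hypothesis DE : D = (2 ^ 24 * r)%N.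
Hypothesis rdom : forall n, (r <= 2 ^ n)%N -> (n ^ 17 <= 2 ^ n)%N.

(** The previous modulus [7 ^ e] must lie in a window: large compared with [log N], so that [N] is
    within exponential reach, but with fourth power small compared with [N], so that the error is
    harmless. It must also fall into the range of [N] treated at level [i]. *)
Lemma choose_scale i N :
  (r ^ 300 * tower i < N)%N -> (N <= r ^ 300 * tower i.+1)%N ->
  exists e, [/\ (2 ^ 15 * r ^ 20 <= 7 ^ e)%N, (7 ^ e <= r ^ 300 * tower i)%N,
    (2 ^ 15 * (7 ^ e) ^ 4 * r ^ 12 <= N)%N & (7 * N <= 2 ^ (7 ^ e %/ D))%N].
Proof.
move=> VN NV; set T := tower i in VN NV *; rewrite [tower i.+1]/= -/T in NV.
have T0 : (0 < T)%N := tower_gt0 i.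
have r0 : (0 < r)%N by apply: leq_trans r24; rewrite expn_gt0.
have re p q : (p <= q)%N -> (r ^ p <= r ^ q)%N by move=> pq; rewrite leq_pexp2l.
have r15 : (2 ^ 15 <= r)%N by apply: leq_trans r24; rewrite leq_exp2l.
have r201 : (2 ^ 8 <= r)%N by apply: leq_trans r24; rewrite leq_exp2l.
have r9 : (2 ^ 9 <= r)%N by apply: leq_trans r24; rewrite leq_exp2l.
have r14 : (14 <= r)%N by apply: leq_trans r201.
have D2 : (D <= r ^ 2)%N by rewrite DE -mulnn leq_mul2r r24 orbT.
have D0 : (0 < D)%N by rewrite DE muln_gt0 expn_gt0 r0.
have N0 : (0 < N)%N by apply: leq_ltn_trans VN.
have VNr : (r ^ 300 <= N)%N.
  by apply: leq_trans (ltnW VN); rewrite leq_pmulr.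
have N7 : (0 < 7 * N)%N by rewrite muln_gt0.
have [l /andP[Nl lN]] := @exists_pow_between 2 (7 * N) isT N7.
have {}lN : (2 ^ l < 14 * N)%N by rewrite (leq_trans lN) // mulnA.
have rl : (r <= 2 ^ l)%N.
  apply: leq_trans Nl; apply: leq_trans (leq_pmull _ _) => //.
  by apply: leq_trans VNr; rewrite -{1}[r]expn1 re.
have l24 : (24 <= l)%N by rewrite -(@leq_exp2l 2) // (leq_trans r24).
(* Exponent 17 of [rdom] splits as 1 + 16: one factor [l] absorbs 14, and [l.+1 <= l ^ 2] takes the
   rest. *)
have l8 : (l.+1 ^ 8 <= N)%N.
  rewrite -(@leq_pmul2l 14) //; apply: leq_trans (ltnW lN).
  apply: leq_trans (rdom rl); rewrite [(l ^ 17)%N]expnS leq_mul //.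
    exact: leq_trans l24.
  by rewrite (expnM l 2 8) leq_exp2r // expnS expn1; apply: (@leq_trans (2 * l)); [lia|rewrite leq_mul2r; lia].
have lT : (l <= T + 301 * r)%N.
  rewrite -(@leq_exp2l 2) // (leq_trans (ltnW lN)) //.
  apply: leq_trans (pow_mul_pow2_le r 301 T).
  by rewrite expnS -mulnA leq_mul.
(* The first summand secures the lower end of the admissible range, the second gives
   [l <= 7 ^ e %/ D] with [7 * N <= 2 ^ l]. *)
pose X := (2 ^ 15 * r ^ 20 + D * l)%N.
have X0 : (0 < X)%N by rewrite addn_gt0 muln_gt0 !expn_gt0 r0.
have Xl : (X <= r ^ 21 * l.+1)%N.
  rewrite mulnS leq_add //; first by rewrite [(r ^ 21)%N]expnS leq_mul2r r15 orbT.
  by rewrite leq_mul2r (leq_trans D2) ?orbT // re.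
have [e /andP[Xe eX]] := @exists_pow_between 7 X isT X0.
exists e; split.
- by apply: leq_trans Xe; rewrite leq_addr.
- apply: leq_trans (ltnW eX) _; apply: (@leq_trans (r ^ 1 * (r ^ 21 * (r ^ 2 * T)))).
    rewrite leq_mul //; first by rewrite expn1 (leq_trans _ r14).
    apply: leq_trans Xl _; rewrite leq_mul2l; apply/orP; right.
    by apply: leq_ltn_trans lT _; apply: lin_lt_quad => //; apply: leq_trans r9.
  by rewrite mulnA mulnA -expnD -expnD leq_mul2r re ?orbT.
(* After squaring, one factor [N >= r ^ 300] pays for the powers of [r] and the other for
   [l.+1 ^ 8]. *)
- rewrite -leq_sqr; apply: (@leq_trans (r ^ 202 * l.+1 ^ 8)); last first.
    by rewrite -mulnn leq_mul // (leq_trans _ VNr) // re.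
  have -> : (r ^ 202 * l.+1 ^ 8 = (r ^ 1 * (r ^ 22 * l.+1) ^ 4 * r ^ 12) ^ 2)%N.
    by rewrite !expnMn -!expnM; ring.
  rewrite leq_exp2r // leq_mul2r leq_mul ?orbT ?expn1 // leq_exp2r //.
  apply: leq_trans (ltnW eX) _; rewrite expnS -mulnA leq_mul //.
  exact: leq_trans r14.
- apply: leq_trans Nl _; rewrite leq_exp2l // leq_divRL //.
  by apply: leq_trans Xe; rewrite mulnC leq_addl.
Qed.

End Scale.

Section Reach.

Variables (R : realType) (a D : nat).
Let r := (7 ^ a)%N.
Hypothesis r24 : (2 ^ 24 <= r)%N.
Hypothesis DE : D = (2 ^ 24 * r)%N.
Hypothesis rdom : forall n, (r <= 2 ^ n)%N -> (n ^ 17 <= 2 ^ n)%N.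
Hypothesis rbase : (7 * r ^ 300 <= 2 ^ (r ^ 2 %/ D))%N.

Let eps : R := 1 / r%:R ^+ 4.
Let beta : R := 1 - 1 / r%:R ^+ 2.

Let r0 : (0 < r)%N. Proof. by rewrite expn_gt0. Qed.
Let rR : 0 < r%:R :> R. Proof. by rewrite ltr0n. Qed.
Let r2R : 2 <= r%:R :> R.
Proof. by rewrite ler_nat (leq_trans _ r24) // -{1}[2%N]expn1 leq_exp2l. Qed.
Let D0 : (0 < D)%N. Proof. by rewrite DE muln_gt0 expn_gt0 r0. Qed.

Let beta01 : 0 < beta <= 1.
Proof.
rewrite /beta gerBl divr_ge0 ?sqr_ge0 // andbT subr_gt0 ltr_pdivrMr ?exprn_gt0 //.
have r1 : 1 <= r%:R :> R by apply: le_trans r2R; rewrite ler1n.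
have := ler_eXnr (isT : (0 < 2)%N) r1; rewrite mul1r; apply: lt_le_trans.
by apply: lt_le_trans r2R; rewrite ltr1n.
Qed.

Lemma scale_step i e e' N F : 3 * 1025 ^+ i <= r%:R :> R ->
  (0 < N)%N -> (7 ^ e' <= 7 * N)%N -> (N <= 7 ^ e')%N ->
  state eps beta (1025 ^+ i / r%:R) (7 ^ e) F ->
  (2 ^ 15 * (7 ^ e) ^ 4 * r ^ 12 <= N)%N -> (7 * N <= 2 ^ (7 ^ e %/ D))%N ->
  exists G : nat -> R,
   [/\ state eps beta (1025 ^+ i.+1 / r%:R) (7 ^ e') G,
       forall d u v, ~~ (7 ^ e' %| d)%N -> (u <= v)%N ->
         \sum_(u <= n < v) G n * G (n + d)%N * G (n + 2 * d)%N
           <= (v - u)%:R * (1 - eps) + N%:R / r%:R ^+ 12 &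
       forall u v, (u <= v)%N ->
         `|\sum_(u <= n < v) G n - (v - u)%:R| <= N%:R / r%:R ^+ 12].
Proof.
move=> ir N0 e'N Ne' stF MN NM; set M := (7 ^ e)%N in stF MN NM *.
have M0 : (0 < M)%N by rewrite expn_gt0.
have MR : 0 < M%:R :> R by rewrite ltr0n.
have M4 : (2 ^ 15 * M ^ 4 <= N)%N by apply: leq_trans MN; rewrite leq_pmulr // expn_gt0 r0.
have ee : (e <= e')%N.
  rewrite -(@leq_exp2l 7) // -/M; apply: leq_trans Ne'; apply: leq_trans M4.
  by rewrite [(M ^ 4)%N]expnS mulnCA leq_pmulr // muln_gt0 [(0 < M ^ _)%N]expn_gt0 M0 expn_gt0.
have e'E : (M * 7 ^ (e' - e) = 7 ^ e')%N by rewrite -expnD subnKC.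
set k := (M %/ D)%N in NM.
have k1 : (0 < k)%N.
  by rewrite lt0n; apply: contraTneq NM => ->; rewrite -ltnNge (@leq_trans 7) // leq_pmulr.
have kM : (k * D <= M)%N by exact: leq_trunc_div.
(* The reason for [D = 2 ^ 24 * r]: as [k >= 1], the left side is at most [2 ^ 24 * k <= M / r], and
   [kap >= 1 / r]. *)
have hk : 2 ^+ 23 * k.+1%:R <= 1025 ^+ i / r%:R * M%:R :> R.
  apply: le_trans (_ : M%:R / r%:R <= _); last first.
    by rewrite mulrAC ler_pM2r ?invr_gt0 // ler_peMl // exprn_ege1 // ler1n.
  rewrite ler_pdivlMr //; apply: le_trans (_ : (k * D)%:R <= _); last by rewrite ler_nat.
  rewrite DE mulnA natrM ler_pM2r // natrM natrX.
  have -> : 2 ^+ 24 = 2 ^+ 23 * 2 :> R by rewrite exprSr.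
  by rewrite [leRHS]mulrCA ler_pM2l ?exprn_gt0 // -natrM ler_nat muln2 -addnn -addn1 leq_add2l.
have [||||||||G [stG Glow Gmean]] := @state_step R eps beta (1025 ^+ i / r%:R) M F (e' - e) k.
- by rewrite oddX orbT.
- exact: beta01.
- exact: stF.
- by apply: le_trans hk; apply: mulr_ege1; rewrite ?exprn_ege1 ?ler1n.
- by rewrite mulrA ler_pdivrMr // mul1r.
- rewrite -(leq_pmul2l M0) e'E; apply: leq_trans Ne'; apply: leq_trans M4.
  by rewrite [(M ^ 4)%N]expnS mulnCA leq_mul.
- apply: leq_trans NM; apply: leq_trans e'N.
  by rewrite leq_exp2l // leq_subr.
- exact: hk.
have err : 2 ^+ 15 * M%:R ^+ 4 <= N%:R / r%:R ^+ 12 :> R.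
  by rewrite ler_pdivlMr ?exprn_gt0 // -!natrX -!natrM ler_nat.
exists G; split.
- by rewrite -e'E exprS -mulrA.
- move=> d u v; rewrite -e'E => h1 h2; apply: le_trans (Glow d u v h1 h2) _.
  by rewrite lerD2l.
- by move=> u v uv; apply: le_trans (Gmean u v uv) err.
Qed.

(** The state produced lives at a modulus one refinement below [N]. Each level inserts one
    exponential, so the reachable [N] grow like the tower. *)
Lemma reach i : 3 * 1025 ^+ i <= r%:R :> R ->
  forall N, (2 ^ 15 * r ^ 20 <= N)%N -> (N <= r ^ 300 * tower i)%N ->
  exists e F, [/\ state eps beta (1025 ^+ i / r%:R) (7 ^ e) F,
    (2 ^ 15 * (7 ^ e) ^ 4 * r ^ 12 <= N)%N & (7 * N <= 2 ^ (7 ^ e %/ D))%N].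
Proof.
elim: i => [|i IH] ir N LN NU.
  have r2 : (7 ^ (a * 2) = r ^ 2)%N by rewrite expnM.
  exists (a * 2)%N; rewrite r2; eexists; split.
  - rewrite expr0; apply: state_base; last by rewrite oddX orbT.
    by apply: leq_trans r24; rewrite leq_exp2l.
  - by apply: leq_trans LN; rewrite -expnM -mulnA -expnD.
  - by apply: leq_trans rbase; rewrite leq_mul // (leq_trans NU) //= muln1.
have ir' : 3 * 1025 ^+ i <= r%:R :> R.
  apply: le_trans ir; rewrite ler_pM2l // exprS ler_peMl ?exprn_ge0 // ler1n //.
have [NV|VN] := leqP N (r ^ 300 * tower i).
  have [e [F [st h1 h2]]] := IH ir' N LN NV.
  exists e, F; split=> //; apply: state_le st; first by have /andP[/ltW] := beta01.
  by rewrite ler_pM2r ?invr_gt0 // exprS ler_peMl ?exprn_ge0 // ler1n.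
have [e [h1 h2 h3 h4]] := choose_scale r24 DE rdom VN NU.
(* The recursive call aims at [7 ^ e] in place of [N]; one refinement then lands exactly on the
   modulus [7 ^ e]. *)
have [e' [F [st g1 g2]]] := IH ir' _ h1 h2.
have M0 : (0 < 7 ^ e)%N by rewrite expn_gt0.
have [G [stG _ _]] := scale_step ir' M0 (leq_pmull _ (isT : (0 < 7)%N)) (leqnn _) st g1 g2.
by exists e, G.
Qed.

(** A last refinement to a modulus at least [N], so that no difference below [N] is a multiple of it
    and the excess at difference 0 is never seen. *)
Lemma popular_difference_free i N : 3 * 1025 ^+ i <= r%:R :> R ->
  (2 ^ 15 * r ^ 20 <= N)%N -> (N <= r ^ 300 * tower i)%N ->
  exists G : nat -> R,
   [/\ forall n, 0 <= G n <= 2,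
       forall d u v, (0 < d < N)%N -> (u <= v)%N ->
         \sum_(u <= n < v) G n * G (n + d)%N * G (n + 2 * d)%N
           <= (v - u)%:R * (1 - eps) + N%:R / r%:R ^+ 12 &
       forall u v, (u <= v)%N ->
         `|\sum_(u <= n < v) G n - (v - u)%:R| <= N%:R / r%:R ^+ 12].
Proof.
move=> ir LN NU.
have [e [F [st h1 h2]]] := reach ir LN NU.
have N0 : (0 < N)%N by apply: leq_trans LN; rewrite muln_gt0 !expn_gt0.
have [e' /andP[Ne e'N]] := @exists_pow_between 7 N isT N0.
have [G [stG Glow Gmean]] := scale_step ir N0 (ltnW e'N) Ne st h1 h2.
exists G; split=> //; first by move=> n; rewrite (st_ge0 stG) (st_le2 stG).
move=> d u v /andP[d0 dN]; apply: Glow.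
by rewrite gtnNdvd // (leq_trans dN).
Qed.

End Reach.

(** * Random rounding *)

Lemma card_fset_nat (A : {fset nat}) N : (forall n, n \in A -> (n <= N)%N) ->
  #|` A| = (\sum_(n < N.+1) ((n : nat) \in A))%N.
Proof.
move=> AN; rewrite -(big_mkord xpredT (fun n => nat_of_bool (n \in A))).
rewrite /index_iota subn0 -big_mkcond sum1_count -size_filter.
apply/perm_size/uniq_perm.
- exact: fset_uniq.
- exact/filter_uniq/(iota_uniq 0 N.+1).
move=> n; rewrite mem_filter mem_iota /= add0n ltnS.
by apply/idP/andP => [An|[]//]; rewrite An AN.
Qed.

Section Rounding.

Variables (R : realType) (N z : nat) (q : nat -> R) (Delta : R).
Hypothesis q01 : forall n, 0 <= q n <= 1.
Hypothesis N0 : (0 < N)%N.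
Hypothesis Delta0 : 0 < Delta.
Hypothesis DeltaN : Delta <= 24 * N%:R.
Hypothesis small : N.+2%:R * expR (- (Delta ^+ 2 / (144 * N%:R))) < 1.

Notation outcome := {ffun 'I_N.+1 -> bool}.

Let mu (i : 'I_N.+1) (b : bool) : R := if b then q i else 1 - q i.

Let mu_ge0 i b : 0 <= mu i b.
Proof. by have /andP[? ?] := q01 i; case: b; rewrite /mu // subr_ge0. Qed.

Let mu1 i : \sum_b mu i b = 1.
Proof. by rewrite big_bool /mu /= addrC subrK. Qed.

Let mean i : \sum_b mu i b * b%:R = q i.
Proof. by rewrite big_bool /= mulr1 mulr0 addr0. Qed.

Let ap_count (d : nat) (w : outcome) : R :=
  \sum_(n : 'I_N.+1 | (z < n)%N && (n + 2 * d <= N)%N)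
    (w n)%:R * ((w (inord (n + d)))%:R * (w (inord (n + 2 * d)))%:R).

Let size_count (w : outcome) : R := \sum_(n : 'I_N.+1 | (z < n)%N) (w n)%:R.

Let upd_diff i s t (w : outcome) (j : 'I_N.+1) :
  `|(upd i s w j)%:R - (upd i t w j)%:R| <= (j == i)%:R :> R.
Proof.
rewrite !ffunE; case: (j == i); last by rewrite subrr normr0.
by case: s; case: t; rewrite /= ?subrr ?normr0 ?subr0 ?sub0r ?normrN ?normr1.
Qed.

Let shift_le1 (P : pred 'I_N.+1) (e : nat) (i : 'I_N.+1) :
  (forall n : 'I_N.+1, P n -> (n + e <= N)%N) ->
  \sum_(n | P n) (inord (n + e) == i)%:R <= 1 :> R.
Proof.
move=> Pe; rewrite big_mkcond /=.
apply: le_trans (_ : \sum_(n : 'I_N.+1) (n == inord (i - e))%:R <= _).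
  apply: ler_sum => n _; case: ifP => // /Pe ne.
  have [E|//] := eqVneq (inord (n + e) : 'I_N.+1) i.
  suff -> : n == inord (i - e) by [].
  by rewrite -E inordK ?ltnS // addnK -val_eqE /= inordK.
rewrite (bigD1 (inord (i - e))) //= eqxx big1 ?addr0 // => n /negPf -> //.
Qed.

(** For fixed [d] a point is the first, middle or last term of at most one progression each. *)
Let ap_count_diff d : bounded_diff (ap_count d) (fun=> 3).
Proof.
move=> i s t w; rewrite -sumrB; apply: le_trans (ler_norm_sum _ _ _) _.
have three (x y u x' y' u' : bool) : `|x%:R * (y%:R * u%:R) - x'%:R * (y'%:R * u'%:R)|
    <= `|x%:R - x'%:R| + `|y%:R - y'%:R| + `|u%:R - u'%:R| :> R.
  have -> : x%:R * (y%:R * u%:R) - x'%:R * (y'%:R * u'%:R) = (x%:R - x'%:R) * (y && u)%:R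
      + (y%:R - y'%:R) * (x' && u)%:R + (u%:R - u'%:R) * (x' && y')%:R :> R.
    by rewrite -!mulnb !natrM; ring.
  have le1 (v : R) (b : bool) : `|v * b%:R| <= `|v|.
    by case: b; rewrite ?mulr1 ?mulr0 ?normr0.
  by do 2 (apply: le_trans (ler_normD _ _) _; apply: lerD => //).
apply: le_trans (_ : \sum_(n : 'I_N.+1 | (z < n)%N && (n + 2 * d <= N)%N)
   ((inord (n + 0) == i)%:R + (inord (n + d) == i)%:R + (inord (n + 2 * d) == i)%:R) <= _).
  apply: ler_sum => n _; apply: le_trans (three _ _ _ _ _ _) _.
  by rewrite addn0 inord_val !lerD // upd_diff.
rewrite !big_split /= (_ : 3 = 1 + 1 + 1); last by ring.
by rewrite !lerD // shift_le1 // => n /andP[_]; lia.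
Qed.

Let size_count_diff : bounded_diff (fun w => - size_count w) (fun=> 3).
Proof.
move=> i s t w; rewrite opprK addrC -sumrB; apply: le_trans (ler_norm_sum _ _ _) _.
apply: le_trans (_ : \sum_(n : 'I_N.+1 | (z < n)%N) (inord (n + 0) == i)%:R <= _).
  by apply: ler_sum => n _; rewrite addn0 inord_val upd_diff.
apply: le_trans (_ : 1 <= _); last by lra.
by apply: shift_le1 => n _; rewrite addn0 -ltnS.
Qed.

Let expect_ap d : (0 < d)%N -> expect mu (ap_count d)
  = \sum_(n : 'I_N.+1 | (z < n)%N && (n + 2 * d <= N)%N) q n * q (n + d)%N * q (n + 2 * d)%N.
Proof.
move=> d0; rewrite expect_sum; apply: eq_bigr => n /andP[_ nN].
have E1 : (inord (n + d) : 'I_N.+1) = (n + d)%N :> nat by rewrite inordK //; lia.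
have E2 : (inord (n + 2 * d) : 'I_N.+1) = (n + 2 * d)%N :> nat by rewrite inordK //; lia.
have N1 : (inord (n + d) == n) = false.
  by apply/eqP => /(congr1 (@nat_of_ord _)); rewrite E1; lia.
have N2 : (inord (n + 2 * d) == n) = false.
  by apply/eqP => /(congr1 (@nat_of_ord _)); rewrite E2; lia.
have N12 : (inord (n + 2 * d) == inord (n + d) :> 'I_N.+1) = false.
  by apply/eqP => /(congr1 (@nat_of_ord _)); rewrite E1 E2; lia.
rewrite (expect_indep mu1 (fun b : bool => b%:R)
   (g := fun w => (w (inord (n + d)))%:R * (w (inord (n + 2 * d)))%:R)); last first.
  by move=> t w; rewrite !ffunE N1 N2.
rewrite (expect_indep mu1 (fun b : bool => b%:R)
   (g := fun w => (w (inord (n + 2 * d)))%:R)); last first.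
  by move=> t w; rewrite !ffunE N12.
rewrite (expect_coord mu1 _ (fun b : bool => b%:R)) !mean.
by rewrite E1 E2 mulrA.
Qed.

Lemma random_rounding : exists A : {fset nat},
  [/\ forall n, n \in A -> (z < n <= N)%N,
      \sum_(z.+1 <= n < N.+1) q n - Delta <= #|` A|%:R &
      forall d, (0 < d)%N -> (num_3AP A d)%:R
        <= \sum_(z.+1 <= n < N.+1 - 2 * d) q n * q (n + d)%N * q (n + 2 * d)%N + Delta].
Proof.
have NR : 0 < N%:R :> R by rewrite ltr0n.
(* The minimizer of [36 * lam ^+ 2 * N - lam * Delta], with minimum [- Delta ^+ 2 / (144 * N)]. The
   constraints number [N.+2]: one per [d <= N], and [None] for the size. *)
pose lam := Delta / (72 * N%:R).
have lam0 : 0 < lam by rewrite divr_gt0 // mulr_gt0.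
pose h (o : option 'I_N.+1) (w : outcome) :=
  lam * (if o is Some d then ap_count d w else - size_count w).
pose c (_ : option 'I_N.+1) (_ : 'I_N.+1) := lam * 3.
pose tau o := expect mu (h o) + lam * Delta.
have hc o : bounded_diff (h o) (c o).
  move=> i s t w; rewrite /h /c -mulrBr normrM gtr0_norm // ler_pM2l //.
  by case: o => [d|]; [exact: ap_count_diff|exact: size_count_diff].
have c1 o i : c o i <= 1.
  rewrite /c /lam mulrAC ler_pdivrMr ?mulr_gt0 // mul1r.
  by have -> : 72 * N%:R = 24 * N%:R * 3 :> R; [ring|rewrite ler_pM2r].
have [|w [wh _]] := exists_all_below (tau := tau) (bad := fun (b : void) (_ : outcome) => false)
    mu_ge0 mu1 hc c1.
  rewrite [X in _ + X]big_pred0 ?addr0; last by case.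
  apply: le_lt_trans small.
  apply: le_trans (_ : \sum_(o : option 'I_N.+1) expR (- (Delta ^+ 2 / (144 * N%:R))) <= _).
    apply: ler_sum => o _; rewrite ler_expR /tau /c sumr_const card_ord.
    have -> : expect mu (h o) + 2 * ((lam * 3) ^+ 2 *+ N.+1) - (expect mu (h o) + lam * Delta)
       = 18 * lam ^+ 2 * (N%:R + 1) - lam * Delta.
      by rewrite -[_ *+ N.+1]mulr_natr -natr1; ring.
    have -> : Delta ^+ 2 / (144 * N%:R) = lam * Delta - 36 * lam ^+ 2 * N%:R.
      by rewrite /lam; field; rewrite gt_eqF.
    have : lam ^+ 2 * 1 <= lam ^+ 2 * N%:R by rewrite ler_pM2l ?exprn_gt0 // ler1n.
    by lra.
  by rewrite sumr_const card_option card_ord -[_ *+ N.+2]mulr_natl.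
have [A inA] : exists A : {fset nat}, forall n,
    (n \in A) = [&& (z < n)%N, w (inord n) & (n <= N)%N].
  exists [fset n in [seq n <- iota 0 N.+1 | (z < n)%N && w (inord n)]]%fset => n.
  by rewrite in_fset mem_filter (mem_iota 0 N.+1) /= -andbA.
have AN n : n \in A -> (n <= N)%N by rewrite inA => /and3P[].
exists A; split.
- by move=> n; rewrite inA => /and3P[-> _ ->].
- have := wh None; rewrite /tau /h expectZ -mulrDr ltr_pM2l // => hs.
  have -> : #|` A|%:R = size_count w.
    rewrite (card_fset_nat AN) natr_sum /size_count [RHS]big_mkcond /=.
    apply: eq_bigr => n _; rewrite inA inord_val leq_ord andbT.
    by case: (z < n)%N; case: (w n).
  have -> : \sum_(z.+1 <= n < N.+1) q n = - expect mu (fun w => - size_count w).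
    have -> : expect mu (fun w => - size_count w) = expect mu (fun w => -1 * size_count w).
      by apply: eq_expect => v; rewrite mulN1r.
    rewrite expectZ mulN1r opprK expect_sum big_geq_mkord /=.
    by apply: eq_bigr => n _; rewrite (expect_coord mu1 _ (fun b : bool => b%:R)) mean.
  by lra.
- move=> d d0.
  have -> : (num_3AP A d)%:R = ap_count d w.
    rewrite /num_3AP (@card_fset_nat _ N); last by move=> n; rewrite !inE => /andP[/AN].
    rewrite natr_sum /ap_count [RHS]big_mkcond /=; apply: eq_bigr => n _.
    rewrite !inE /= !inA inord_val leq_ord andbT.
    case: (ltnP z n) => //= zn.
    rewrite !(leq_trans zn (leq_addr _ _)) /=.
    case: (leqP (n + 2 * d) N) => nd; last by rewrite !andbF.
    have -> : (n + d <= N)%N by apply: leq_trans nd; rewrite leq_add2l leq_pmull.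
    rewrite !andbT.
    by case: (w n); case: (w (inord (n + d))); case: (w (inord (n + 2 * d)));
      rewrite /= ?(mulr0, mul0r, mulr1).
  have sumE : \sum_(z.+1 <= n < N.+1 - 2 * d) q n * q (n + d)%N * q (n + 2 * d)%N
    = \sum_(n : 'I_N.+1 | (z < n)%N && (n + 2 * d <= N)%N) q n * q (n + d)%N * q (n + 2 * d)%N.
    rewrite (big_nat_widen _ _ N.+1) ?leq_subr // big_geq_mkord /=.
    by apply: eq_bigl => n; rewrite andbC; congr (_ && _); rewrite ltn_subRL ltnS addnC.
  (* For [d > N] the index [inord d] would be meaningless, but then no progression fits. *)
  have [dN|Nd] := leqP d N; last first.
    rewrite /ap_count big_pred0 => [|n]; last first.
      apply/negbTE/negP => /andP[_]; rewrite leqNgt (leq_trans Nd) //.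
      by rewrite mul2n -addnn addnCA leq_addr.
    rewrite addr_ge0 ?(ltW Delta0) //; apply: sumr_ge0 => n _.
    by rewrite !mulr_ge0 //; have /andP[] := q01 n; have /andP[] := q01 (n + d);
      have /andP[] := q01 (n + 2 * d).
  have := wh (Some (inord d)); rewrite /tau /h expectZ -mulrDr ltr_pM2l // inordK //.
  by rewrite expect_ap // -sumE => /ltW.
Qed.

End Rounding.

(** * Sets without three-term progressions *)

Definition from_digits (b q : nat) (a : nat -> nat) : nat := (\sum_(i < q) a i * b ^ i)%N.

Lemma from_digits_recl b q a :
  from_digits b q.+1 a = (from_digits b q (fun i => a i.+1) * b + a 0)%N.
Proof.
rewrite /from_digits big_ord_recl expn0 muln1 addnC big_distrl /=; congr (_ + _)%N.
by apply: eq_bigr => i _; rewrite /bump add1n expnSr mulnA.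
Qed.

Lemma from_digits_lt b q a : (forall i, (a i < b)%N) -> (from_digits b q a < b ^ q)%N.
Proof.
elim: q a => [|q IH] a ab; first by rewrite /from_digits big_ord0.
rewrite from_digits_recl expnSr.
have := IH (fun i => a i.+1) (fun i => ab i.+1); have := ab 0%N.
move: (from_digits _ _ _) (b ^ q)%N => x y; nia.
Qed.

Lemma from_digits_inj b q a c : (forall i, (a i < b)%N) -> (forall i, (c i < b)%N) ->
  from_digits b q a = from_digits b q c -> forall i, (i < q)%N -> a i = c i.
Proof.
elim: q a c => [|q IH] a c ab cb //; rewrite !from_digits_recl => E.
have E0 : a 0%N = c 0%N.
  by have := congr1 (modn^~ b) E; rewrite !modnMDl !modn_small.
have b0 : (0 < b)%N by apply: leq_ltn_trans (ab 0%N).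
move: E; rewrite E0 => /addIn /eqP; rewrite eqn_pmul2r // => /eqP E [|i] //.
exact: (IH (fun i => a i.+1) (fun i => c i.+1)).
Qed.

Section Sphere.

Variables (q k : nat).
Hypothesis k0 : (0 < k)%N.

Notation point := {ffun 'I_q -> 'I_k}.

Let dig (f : point) (i : nat) : nat := if insub i is Some j then f j else 0%N.

Let digE (f : point) (i : 'I_q) : dig f i = f i.
Proof. by rewrite /dig valK. Qed.

Let dig_lt f i : (dig f i < k)%N.
Proof. by rewrite /dig; case: insubP. Qed.

(** Behrend's construction: digits below [k] in base [2 * k] make the sum of two codes free of
    carries, so an equation between codes can be read digit by digit. *)
Let code (f : point) := from_digits (2 * k) q (dig f).

Let sqnorm (f : point) : nat := (\sum_i f i ^ 2)%N.

Let dig_lt2 f i : (dig f i < 2 * k)%N.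
Proof. by apply: leq_trans (dig_lt f i) _; rewrite leq_pmull. Qed.

Let code_inj : injective code.
Proof.
move=> f g E; apply/ffunP => i; apply: val_inj => /=.
by rewrite -!digE; apply: (from_digits_inj (dig_lt2 f) (dig_lt2 g) E).
Qed.

(* On a sphere the midpoint of two distinct points is never on the sphere. *)
Let code_no_midpoint f g h : sqnorm f = sqnorm g -> sqnorm h = sqnorm g ->
  (code f + code h = 2 * code g)%N -> f = h.
Proof.
move=> fg hg E.
have dE (i : 'I_q) : (f i + h i = 2 * g i)%N.
  rewrite -!digE.
  apply: (@from_digits_inj (2 * k) q (fun i => dig f i + dig h i)%N (fun i => 2 * dig g i)%N) => //.
  - by move=> j; have := dig_lt f j; have := dig_lt h j; lia.
  - by move=> j; have := dig_lt g j; lia.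
  - move: E; rewrite /code /from_digits -big_split big_distrr /= => E.
    under eq_bigr do rewrite mulnDl.
    by rewrite E; apply: eq_bigr => j _; rewrite mulnA.
have S0 : \sum_i ((f i)%:Z - (h i)%:Z) ^+ 2 = 0.
  have sqZ (u : point) : (sqnorm u)%:Z = \sum_i (u i)%:Z ^+ 2.
    rewrite /sqnorm (big_morph Posz PoszD (erefl 0%:Z)).
    by apply: eq_bigr => i _; rewrite -!natz natrX.
  transitivity (2 * (sqnorm f)%:Z + 2 * (sqnorm h)%:Z - 4 * (sqnorm g)%:Z); last first.
    by rewrite fg hg; ring.
  rewrite !sqZ !mulr_sumr -big_split -sumrB; apply: eq_bigr => i _ /=.
  have -> : 4 * (g i)%:Z ^+ 2 = ((f i)%:Z + (h i)%:Z) ^+ 2.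
    have -> : (f i)%:Z + (h i)%:Z = 2 * (g i)%:Z by have := dE i; lia.
    by ring.
  by ring.
apply/ffunP => i; apply: val_inj => /=.
have nn j : true -> 0 <= ((f j)%:Z - (h j)%:Z) ^+ 2 by rewrite sqr_ge0.
have := psumr_eq0P nn S0 (erefl true : xpredT i).
by move=> /eqP; rewrite sqrf_eq0 subr_eq0 => /eqP [].
Qed.

(** Pigeonhole: [k ^ q] points share fewer than [q * k ^ 2 + 1] squared norms. *)
Lemma large_sphere : (0 < q)%N -> exists s : nat,
  (k ^ q <= #|[set f : point | sqnorm f == s]| * (q * k ^ 2))%N.
Proof.
move=> q0; set n := (q * k ^ 2)%N.
have n0 : (0 < n)%N by rewrite muln_gt0 q0 expn_gt0 k0.
have sn (f : point) : (sqnorm f < n)%N.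
  have -> : n = (\sum_(i < q) k ^ 2)%N by rewrite sum_nat_const card_ord.
  rewrite /sqnorm; have i0 := Ordinal q0.
  rewrite (bigD1 i0) //= [X in (_ < X)%N](bigD1 i0) //= -addSn leq_add //.
    by rewrite ltn_exp2r.
  by apply: leq_sum => i _; rewrite leq_exp2r // ltnW.
have [/existsP[s hs]|] := boolP [exists s : 'I_n, (k ^ q <= #|[set f : point | sqnorm f == s]| * n)%N].
  by exists s.
rewrite negb_exists => /forallP all_small; exfalso.
have tot : (\sum_(s < n) #|[set f : point | sqnorm f == s]| = k ^ q)%N.
  rewrite -[q in RHS]card_ord -[k in RHS]card_ord -card_ffun -sum1_card.
  rewrite (partition_big (fun f : point => Ordinal (sn f)) predT) //=.
  by apply: eq_bigr => s _; rewrite -sum1_card; apply: eq_bigl => f; rewrite inE.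
have : (\sum_(s < n) #|[set f : point | sqnorm f == s]| * n < \sum_(s < n) k ^ q)%N.
  have s0 := Ordinal n0.
  rewrite (bigD1 s0) //= [X in (_ < X)%N](bigD1 s0) //= -addSn leq_add //.
    by rewrite ltnNge all_small.
  by apply: leq_sum => s _; rewrite ltnW // ltnNge all_small.
by rewrite -big_distrl /= tot sum_nat_const card_ord mulnC ltnn.
Qed.

Lemma sphere_AP_free N : (0 < q)%N -> ((2 * k) ^ q <= N)%N -> exists A : {fset nat},
  [/\ (A `<=` interval1 N)%fset, (k ^ q <= #|` A| * (q * k ^ 2))%N &
      forall d, (0 < d)%N -> num_3AP A d = 0%N].
Proof.
move=> q0 kN; have [s hs] := large_sphere q0.
set S := [set f : point | _] in hs.
have [A inA cA] : exists2 A : {fset nat},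
    (forall n, n \in A <-> exists2 f, f \in S & n = (code f).+1) & #|` A| = #|S|.
  exists [fset n in [seq (code f).+1 | f <- enum S]]%fset.
    move=> n; rewrite in_fset; split=> [/mapP[f fS ->]|[f fS ->]].
      by exists f; rewrite // -mem_enum.
    by apply/mapP; exists f; rewrite // mem_enum.
  rewrite card_fseq undup_id ?size_map -?cardE //.
  by rewrite map_inj_uniq ?enum_uniq // => f g [] /code_inj.
exists A; split; last 2 first.
- by rewrite cA.
- move=> d d0; apply/eqP; rewrite cardfs_eq0; apply/eqP/fsetP => x.
  rewrite !inE; apply/negbTE/negP => /andP[/inA[f]]; rewrite inE => /eqP fs xE.
  move=> /andP[/inA[g]]; rewrite inE => /eqP gs yE /inA[h]; rewrite inE => /eqP hs' zE.
  have fh : f = h by apply: (@code_no_midpoint f g h); rewrite ?fs ?gs ?hs' //; lia.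
  by move: zE; rewrite -fh xE; lia.
apply/fsubsetP => n /inA[f _ ->]; rewrite in_fset mem_iota /=.
by rewrite add1n ltnS (leq_trans _ kN) // from_digits_lt // => i; apply: dig_lt2.
Qed.

End Sphere.

(** Spheres in a fixed dimension depending on [B] already have density above [N ^ (- 1 / B)] once
    [N] is large; for bounded [N] the choice of [alpha1] makes a single point dense enough. *)
Lemma sparse_AP_free (R : realType) (B : nat) : (0 < B)%N -> exists2 alpha1 : R, 0 < alpha1 &
  forall alpha N, 0 < alpha -> alpha <= alpha1 -> (0 < N)%N -> alpha ^+ B * N%:R <= 1 ->
  exists A : {fset nat},
  [/\ (A `<=` interval1 N)%fset, alpha * N%:R <= #|` A|%:R &
      forall d, (0 < d)%N -> num_3AP A d = 0%N].
Proof.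
(* This dimension balances the exponents of [k]: [q * (B - 1) + 2 * B], plus [B] from
   [(4 ^ q * q) ^ B <= k ^ B], equals [q * B]. *)
move=> B0; have [q qE] : exists q, q = (3 * B)%N by exists (3 * B)%N.
pose k1 := (4 ^ q * q)%N.
have q0 : (0 < q)%N by rewrite qE muln_gt0.
have k10 : (0 < k1)%N by rewrite muln_gt0 expn_gt0.
have N10 : (0 < (2 * k1) ^ q)%N by rewrite expn_gt0 muln_gt0 k10.
exists (1 / ((2 * k1) ^ q)%:R); first by rewrite divr_gt0 // ltr0n.
move=> alpha N a0 aN N0 aB.
have [Nk|kN] := leqP N ((2 * k1) ^ q).
  exists [fset 1%N]%fset; split.
  - by apply/fsubsetP => n; rewrite in_fset1 => /eqP ->; rewrite in_fset mem_iota /= add1n ltnS.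
  - rewrite cardfs1; move: aN; rewrite ler_pdivlMr ?ltr0n //; apply: le_trans.
    by rewrite ler_pM2l // ler_nat.
  - move=> d d0; apply/eqP; rewrite cardfs_eq0; apply/eqP/fsetP => x.
    rewrite !inE; apply/negbTE/negP => /andP[/eqP ->] /andP[/eqP].
    by move: d0; case: d.
have [k [k1k kN' Nk']] : exists k, [/\ (k1 <= k)%N, ((2 * k) ^ q <= N)%N & (N < (4 * k) ^ q)%N].
  have exP : exists k, ((2 * k) ^ q <= N)%N by exists k1; exact: ltnW.
  have ubP k : ((2 * k) ^ q <= N)%N -> (k <= N)%N.
    apply: leq_trans; apply: leq_trans (leq_pmull k (isT : (0 < 2)%N)) _.
    have [->//|k0] := posnP k.
    by rewrite -{1}[(2 * k)%N]expn1 leq_pexp2l // muln_gt0.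
  case: (ex_maxnP exP ubP) => k km kmax; have k1k := kmax _ (ltnW kN).
  exists k; split=> //; rewrite ltnNge; apply/negP => h.
  have : (k.+1 <= k)%N by apply: kmax; apply: leq_trans h; rewrite leq_exp2r //; lia.
  by rewrite ltnn.
have k0 : (0 < k)%N := leq_trans k10 k1k.
have [A [AN cA APA]] := sphere_AP_free k0 q0 kN'.
exists A; split=> //.
have kR : 0 < k%:R :> R by rewrite ltr0n.
have c0 : 0 < (q * k ^ 2)%:R :> R by rewrite ltr0n muln_gt0 q0 expn_gt0 k0.
rewrite -(ler_pM2r c0) -natrM; apply: le_trans (_ : (k ^ q)%:R <= _); last by rewrite ler_nat.
rewrite -(@ler_pXn2r R B) // ?nnegrE ?mulr_ge0 ?(ltW a0) //.
have -> : (alpha * N%:R * (q * k ^ 2)%:R) ^+ B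
    = (alpha ^+ B * N%:R) * ((N ^ B.-1) * (q * k ^ 2) ^ B)%N%:R.
  have NB : N%:R ^+ B = N%:R * N%:R ^+ B.-1 :> R by rewrite -exprS prednK.
  by move: (q * k ^ 2)%N => u; rewrite natrM !natrX !exprMn NB; ring.
apply: le_trans (_ : ((N ^ B.-1) * (q * k ^ 2) ^ B)%N%:R <= _).
  by rewrite ler_piMl.
rewrite -natrX ler_nat.
apply: (@leq_trans (((4 * k) ^ q) ^ B.-1 * (q * k ^ 2) ^ B)).
  by rewrite leq_mul2r; apply/orP; right; case: (B.-1) => // b; rewrite leq_exp2r // ltnW.
apply: (@leq_trans ((4 ^ q * q) ^ B * (k ^ (q * B.-1 + 2 * B)))).
  rewrite -!expnM !expnMn -!expnM [(k ^ (_ + _))%N]expnD.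
  rewrite mulnACA -[(k ^ B * k ^ B)%N]expnD addnn -mul2n; apply: leq_mul => //; apply: leq_mul => //.
  by rewrite leq_pexp2l // leq_mul2l leq_pred orbT.
apply: (@leq_trans (k ^ B * k ^ (q * B.-1 + 2 * B))).
  by rewrite leq_mul2r leq_exp2r ?k1k ?orbT.
by rewrite -expnD -expnM leq_pexp2l // qE; case: (B) B0 => //= b _; nia.
Qed.

(** * Choice of parameters *)

Lemma scale_threshold : exists r0, forall r, (r0 <= r)%N ->
  [/\ (2 ^ 24 <= r)%N, forall n, (r <= 2 ^ n)%N -> (n ^ 17 <= 2 ^ n)%N &
      (7 * r ^ 300 <= 2 ^ (r ^ 2 %/ (2 ^ 24 * r)))%N].
Proof.
have [n0 hn0] := expn_dominates 17; have [n1 hn1] := expn_dominates 602.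
have [K KE] : exists K, K = (2 ^ 24)%N by exists (2 ^ 24)%N.
have K7 : (7 <= K)%N by rewrite KE (@leq_trans (2 ^ 3)) // leq_exp2l.
rewrite -KE.
exists (2 ^ n0 + K * (n1 + 2 * K))%N => r hr; split.
- apply: leq_trans hr; apply: leq_trans (leq_addl _ _).
  by rewrite leq_pmulr // addn_gt0 muln_gt0 (leq_trans _ K7) ?orbT.
- move=> n rn; apply: hn0; rewrite -(@leq_exp2l 2) //; apply: leq_trans rn.
  by apply: leq_trans hr; apply: leq_addr.
- have K0 : (0 < K)%N by apply: leq_trans K7.
  have Kr : (K * (n1 + 2 * K) <= r)%N by apply: leq_trans hr; apply: leq_addl.
  have r0 : (0 < r)%N by apply: leq_trans Kr; rewrite muln_gt0 K0 addn_gt0 muln_gt0 K0 orbT.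
  have r7 : (7 <= r)%N.
    by apply: leq_trans Kr; apply: leq_trans K7 _; rewrite leq_pmulr // addn_gt0 muln_gt0 K0 orbT.
  rewrite -mulnn divnMr //; set m := (r %/ K)%N.
  have mn : (n1 + 2 * K <= m)%N by rewrite leq_divRL // mulnC.
  have rm : (r < K * m.+1)%N by rewrite mulnC ltn_ceil.
  apply: (@leq_trans (m ^ 602)); last by apply: hn1; apply: leq_trans mn; apply: leq_addr.
  (* The 602 is twice 301: [r < K * m.+1 <= 2 * K * m <= m ^ 2]. *)
  apply: (@leq_trans (r ^ 301)); first by rewrite expnS leq_mul2r r7 orbT.
  rewrite (expnM m 2 301) leq_exp2r //; apply: leq_trans (ltnW rm) _.
  have Km : (2 * K <= m)%N by apply: leq_trans mn; apply: leq_addl.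
  have m0 : (0 < m)%N by apply: leq_trans Km; rewrite muln_gt0 K0.
  apply: (@leq_trans (2 * K * m)); last by rewrite -mulnn leq_mul2r Km orbT.
  by rewrite -mulnA mulnCA leq_mul2l mul2n -addnn -addn1 leq_add2l m0 orbT.
Qed.

(** Here [x] is [N], [z] the length of the empty initial segment and [L] the number of starting
    points beyond it, so that [L + z] is [N - 2 * d]. Inflating the density by [1 + 4 * t] costs a
    factor at most [1 + 13 * t], covered by half of the gain [eta]. The additive errors do not
    shrink with [L]; near [d = N / 2] they are paid for by [z] alone. *)
Lemma count_bound (R : realType) (al eps eta t L z x E S : R) :
  0 < al -> 0 < t -> t <= 1 / 64 -> 26 * t <= eta -> eta <= 1 -> eps <= al ^+ 3 * eta / 4 ->
  0 <= L -> x * t <= z -> 0 <= x -> 0 <= E -> E <= x * t / 8 ->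
  S <= (al * (1 + 4 * t)) ^+ 3 * (L * (1 - eta) + E) + al ^+ 3 * x * t / 4 ->
  S <= (al ^+ 3 - eps) * (L + z).
Proof.
move=> al0 t0 t64 te e1 epsle L0 xz x0 E0 Ex SS.
have c0 : 0 < al ^+ 3 by rewrite exprn_gt0.
have xt0 : 0 <= x * t by rewrite mulr_ge0 // ltW.
have z0 : 0 <= z by apply: le_trans xz.
apply: le_trans (_ : al ^+ 3 * (1 - eta / 4) * (L + z) <= _); last first.
  by rewrite ler_wpM2r ?addr_ge0 //; lra.
apply: le_trans SS _; rewrite exprMn.
have t3 : (1 + 4 * t) ^+ 3 <= 1 + 13 * t.
  have -> : (1 + 4 * t) ^+ 3 = 1 + 12 * t + t * (48 * t + 64 * (t * t)) by ring.
  have tt : t * t <= t * 1 by rewrite ler_pM2l //; lra.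
  have : t * (48 * t + 64 * (t * t)) <= t * 1.
    rewrite ler_pM2l //.
    have : t * t <= t * (1 / 64) by rewrite ler_pM2l.
    by lra.
  by lra.
have LE0 : 0 <= L * (1 - eta) + E by rewrite addr_ge0 // mulr_ge0 // subr_ge0.
apply: le_trans (_ : al ^+ 3 * ((1 + 13 * t) * (L * (1 - eta) + E)) + al ^+ 3 * x * t / 4 <= _).
  by rewrite lerD2r -mulrA ler_pM2l // ler_wpM2r.
have -> : al ^+ 3 * ((1 + 13 * t) * (L * (1 - eta) + E)) + al ^+ 3 * x * t / 4
  = al ^+ 3 * ((1 + 13 * t) * (L * (1 - eta) + E) + x * t / 4) by ring.
rewrite -[leRHS]mulrA ler_pM2l //.
have h1 : (1 + 13 * t) * (1 - eta) <= 1 - eta / 2.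
  have : 0 <= 13 * t * eta by rewrite !mulr_ge0 //; lra.
  by lra.
have h2 : (1 + 13 * t) * (1 - eta) * L <= (1 - eta / 2) * L by rewrite ler_wpM2r.
have h3 : (1 + 13 * t) * E <= 2 * E by rewrite ler_wpM2r //; lra.
have h4 : (1 - eta / 4) * (x * t) <= (1 - eta / 4) * z by rewrite ler_wpM2l //; lra.
have h5 : 3 / 4 * (x * t) <= (1 - eta / 4) * (x * t) by rewrite ler_wpM2r //; lra.
have h6 : 0 <= eta / 4 * L by rewrite mulr_ge0 //; lra.
lra.
Qed.

(** The emptied segment and the mean error remove at most [3 / 2 * (x * t)] from [x]; the inflation
    [1 + 4 * t] restores this and leaves room for the rounding deviation. *)
Lemma size_bound (R : realType) (al t z x E : R) :
  0 < al -> al <= 1 -> 0 < t -> t <= 1 / 64 -> 1 <= x * t / 4 -> z <= x * t + 1 ->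
  E <= x * t / 8 ->
  al * x <= al * (1 + 4 * t) * (x - z - E) - al ^+ 3 * x * t / 4.
Proof.
move=> al0 al1 t0 t64 x1 zx Ex.
have xt0 : 0 < x * t by lra.
have -> : al * (1 + 4 * t) * (x - z - E) - al ^+ 3 * x * t / 4
  = al * ((1 + 4 * t) * (x - z - E) - al ^+ 2 * (x * t) / 4) by ring.
rewrite ler_pM2l //.
have h1 : (1 + 4 * t) * (x - 3 / 2 * (x * t)) <= (1 + 4 * t) * (x - z - E).
  by rewrite ler_pM2l; lra.
have h2 : al ^+ 2 * (x * t) <= 1 * (x * t).
  by rewrite ler_pM2r // exprn_ile1 // ltW.
have h3 : t * (x * t) <= 1 / 64 * (x * t) by rewrite ler_pM2r.
move: h1; have -> : (1 + 4 * t) * (x - 3 / 2 * (x * t)) = x + 5 / 2 * (x * t) - 6 * (t * (x * t)) by field.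
lra.
Qed.

Section ScaleFacts.

Variables (R : realType) (r x al : R).
Hypothesis r64 : 9216 <= r.
Hypothesis rx : r ^+ 40 <= x.
Hypothesis al0 : 0 < al.
Hypothesis al4 : al <= 1 / 4.
Hypothesis ral : 1 <= r * al.

Let t : R := 1 / r ^+ 5.

Let r0 : 0 < r. Proof. by apply: lt_le_trans r64. Qed.
Let rp0 p : 0 < r ^+ p. Proof. by rewrite exprn_gt0. Qed.
Let r1 : 1 <= r. Proof. by apply: le_trans r64; rewrite ler1n. Qed.
Let rp p q : (p <= q)%N -> r ^+ p <= r ^+ q.
Proof. by move=> pq; rewrite ler_weXn2l. Qed.
Let x0 : 0 < x. Proof. exact: lt_le_trans (rp0 40) rx. Qed.
Let t0 : 0 < t. Proof. by rewrite divr_gt0. Qed.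
Lemma scale_t_le : t <= 1 / 64.
Proof.
rewrite ler_pdivrMr // mulrC mulrA ler_pdivlMr // mul1r mulr1.
by apply: le_trans (_ : r <= _); [move: r64; lra|rewrite -{1}[r]expr1 rp].
Qed.

Lemma scale_err_le : x / r ^+ 12 <= x * t / 8.
Proof.
have -> : x * t / 8 = x / (r ^+ 5 * 8) by rewrite /t; field; rewrite gt_eqF.
rewrite ler_pM2l // lef_pV2 ?posrE ?mulr_gt0 // -[12%N]/(5 + 7)%N exprD ler_pM2l //.
by apply: le_trans (_ : r <= _); [move: r64; lra|rewrite -{1}[r]expr1 rp].
Qed.

Lemma scale_one_le : 1 <= x * t / 4.
Proof.
have -> : x * t / 4 = x / (r ^+ 5 * 4) by rewrite /t; field; rewrite gt_eqF.
rewrite ler_pdivlMr ?mulr_gt0 // mul1r; apply: le_trans rx.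
apply: le_trans (rp (isT : 6 <= 40)%N); rewrite (exprSr r 5) ler_pM2l //.
by move: r64; lra.
Qed.

Lemma scale_start_le z : z <= x * t + 1 -> z <= x.
Proof.
have h1 := scale_one_le; have : x * t <= x * (1 / 64) by rewrite ler_pM2l // scale_t_le.
lra.
Qed.

Lemma scale_density : 0 <= al * (1 + 4 * t) * 2 <= 1.
Proof.
have h := scale_t_le; apply/andP; split.
  by rewrite !mulr_ge0 ?(ltW al0) // addr_ge0 // mulr_ge0 // ltW.
have : al * (1 + 4 * t) <= 1 / 4 * (1 + 4 * (1 / 64)).
  by rewrite ler_pM ?(ltW al0) //; [rewrite addr_ge0 // mulr_ge0 // ltW|lra].
lra.
Qed.

Lemma scale_gain : 26 * t <= 1 / r ^+ 4 /\ 1 / r ^+ 4 <= 1.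
Proof.
split; last by rewrite ler_pdivrMr // mul1r exprn_ege1.
have -> : 1 / r ^+ 4 = r * t by rewrite /t; field; rewrite gt_eqF.
by rewrite ler_pM2r //; move: r64; lra.
Qed.

Lemma scale_dev_le : al ^+ 3 * x * t / 4 <= 24 * x.
Proof.
have -> : al ^+ 3 * x * t / 4 = al ^+ 3 * t / 4 * x by ring.
rewrite ler_pM2r //.
have : al ^+ 3 * t <= 1 * (1 / 64).
  rewrite ler_pM ?scale_t_le ?exprn_ge0 ?(ltW al0) ?(ltW t0) // exprn_ile1 ?(ltW al0) //.
  by apply: le_trans al4 _; lra.
lra.
Qed.

Lemma scale_dev_expR :
  (x + 2) * expR (- ((al ^+ 3 * x * t / 4) ^+ 2 / (144 * x))) < 1.
Proof.
(* [w] is [y] with [al] replaced by its lower bound [1 / r]. As [x >= r ^ 40], the quartic term of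
   the exponential at [w] already exceeds [x ^ 2]. *)
set y := _ / _; pose w := x / (2304 * r ^+ 16).
have w0 : 0 <= w by rewrite divr_ge0 ?(ltW x0) // mulr_ge0 // ltW.
have wy : w <= y.
  have -> : y = w * (r * al) ^+ 6 by rewrite /y /w /t; field; rewrite !gt_eqF.
  by rewrite ler_peMr // exprn_ege1.
have x2 : 2 <= x.
  by apply: le_trans rx; apply: le_trans (rp (isT : 1 <= 40)%N); rewrite expr1; move: r64; lra.
have xx : x ^+ 2 <= w ^+ 4 / 24.
  have -> : w ^+ 4 / 24 = x ^+ 2 * (x ^+ 2 / (24 * (2304 ^+ 4 * r ^+ 64))).
    by rewrite /w; field; rewrite gt_eqF.
  rewrite ler_peMr ?sqr_ge0 // ler_pdivlMr ?mulr_gt0 ?exprn_gt0 // mul1r.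
  apply: le_trans (_ : (r ^+ 40) ^+ 2 <= _); last by rewrite lerXn2r ?nnegrE ?(ltW (rp0 _)) ?(ltW x0).
  rewrite -exprM; apply: le_trans (rp (isT : 69 <= 40 * 2)%N).
  rewrite -[69%N]/(1 + (4 + 64))%N exprD [r ^+ (4 + _)]exprD expr1.
  have h4 : 2304 ^+ 4 <= r ^+ 4.
    by rewrite lerXn2r ?nnegrE ?(ltW r0) //; move: r64; lra.
  apply: ler_pM => //; first by rewrite mulr_ge0 ?exprn_ge0 ?(ltW r0).
    by move: r64; lra.
  by rewrite ler_pM2r.
have ey : x + 2 < expR y.
  have := @expR_ge1Dxn R y 3 (le_trans w0 wy).
  have : w ^+ 4 / 24 <= y ^+ 4 / 24.
    rewrite ler_pM2r ?invr_gt0 //.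
    by apply: lerXn2r => //; rewrite nnegrE // (le_trans w0 wy).
  have -> : (4`!)%:R = 24 :> R by [].
  have : 2 * x <= x ^+ 2 by rewrite expr2 ler_pM2r.
  by move: xx x2; lra.
rewrite expRN -/(_ / _) ltr_pdivrMr ?expR_gt0 // mul1r //.
Qed.

End ScaleFacts.

Section Assembly.

Variables (R : realType) (al eps : R) (N a i : nat).
Let r := (7 ^ a)%N.
Hypothesis al0 : 0 < al.
Hypothesis al4 : al <= 1 / 4.
Hypothesis ral : 1 <= r%:R * al.
Hypothesis eps0 : 0 < eps.
Hypothesis eps_r : 4 * r%:R ^+ 4 * eps <= al ^+ 3.
Hypothesis rN : (r ^ 40 <= N)%N.
Hypothesis r24 : (2 ^ 24 <= r)%N.
Hypothesis rdom : forall n, (r <= 2 ^ n)%N -> (n ^ 17 <= 2 ^ n)%N.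
Hypothesis rbase : (7 * r ^ 300 <= 2 ^ (r ^ 2 %/ (2 ^ 24 * r)))%N.
Hypothesis ir : 3 * 1025 ^+ i <= r%:R :> R.
Hypothesis NU : (N <= r ^ 300 * tower i)%N.

Lemma main_case : exists A : {fset nat}, [/\ (A `<=` interval1 N)%fset,
  al * N%:R <= #|` A|%:R &
  forall d : nat, (0 < d)%N -> d%:R <= N%:R / 2 :> R ->
    (num_3AP A d)%:R <= (al ^+ 3 - eps) * (N%:R - 2 * d%:R)].
Proof.
have r0 : (0 < r)%N by rewrite expn_gt0.
have rR : 0 < r%:R :> R by rewrite ltr0n.
have rbig : 2 ^+ 24 <= r%:R :> R by rewrite -natrX ler_nat.
have r64 : 9216 <= r%:R :> R.
  by apply: le_trans (_ : 2 ^+ 14 <= _); [lra|apply: le_trans rbig; rewrite ler_weXn2l // ler1n].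
have LN : (2 ^ 15 * r ^ 20 <= N)%N.
  apply: leq_trans rN; rewrite -[40%N]/(20 + 20)%N expnD leq_mul2r; apply/orP; right.
  apply: (@leq_trans r); first by apply: leq_trans r24; rewrite leq_exp2l.
  by rewrite -{1}[r]expn1 leq_pexp2l.
have N0 : (0 < N)%N by apply: leq_trans rN; rewrite expn_gt0 r0.
have xR : 0 < N%:R :> R by rewrite ltr0n.
have rNR : r%:R ^+ 40 <= N%:R :> R by rewrite -natrX ler_nat.
have [F [F02 Flow Fmean]] := popular_difference_free r24 erefl rdom rbase ir LN NU.
(* Small compared with the gain [1 / r ^ 4], large compared with the relative error [1 / r ^ 12]. *)
pose t : R := 1 / r%:R ^+ 5.
have rp0 p : 0 < r%:R ^+ p :> R by rewrite exprn_gt0.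
have t0 : 0 < t by rewrite divr_gt0.
have [z /andP[zx1 zx2]] := @exists_nat_ceil R (N%:R * t) (ltW (mulr_gt0 xR t0)).
have E0 : 0 <= N%:R / r%:R ^+ 12 :> R by rewrite divr_ge0 // ltW.
have Ext : N%:R / r%:R ^+ 12 <= N%:R * t / 8 := scale_err_le r64 rNR.
have xt1 : 1 <= N%:R * t / 4 := scale_one_le r64 rNR.
have t64 : t <= 1 / 64 := scale_t_le r64.
pose al' := al * (1 + 4 * t).
have al'2 : 0 <= al' * 2 <= 1 := scale_density r64 al0 al4.
have al'0 : 0 <= al' by rewrite mulr_ge0 ?(ltW al0) // addr_ge0 // mulr_ge0 // ltW.
pose q n := al' * F n.
have q01 n : 0 <= q n <= 1.
  have /andP[f0 f2] := F02 n; have /andP[h1 h2] := al'2.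
  rewrite mulr_ge0 //=; apply: le_trans h2; rewrite ler_wpM2l //.
pose Delta := al ^+ 3 * N%:R * t / 4.
have D0 : 0 < Delta by rewrite !mulr_gt0 ?invr_gt0 // exprn_gt0.
have D24 : Delta <= 24 * N%:R := scale_dev_le r64 rNR al0 al4.
have small : N.+2%:R * expR (- (Delta ^+ 2 / (144 * N%:R))) < 1.
  by have := scale_dev_expR r64 rNR ral; rewrite -natrD addn2.
have [A [Az cA lowA]] := random_rounding z q01 N0 D0 D24 small.
have zN : (z <= N)%N.
  by rewrite -(ler_nat R); apply: (scale_start_le r64 rNR zx2).
exists A; split.
- apply/fsubsetP => n /Az /andP[zn nN]; rewrite in_fset mem_iota add1n ltnS nN andbT.
  exact: leq_ltn_trans zn.
- apply: le_trans cA.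
  have -> : \sum_(z.+1 <= n < N.+1) q n = al' * \sum_(z.+1 <= n < N.+1) F n by rewrite mulr_sumr.
  have := Fmean z.+1 N.+1 zN; rewrite subSS natrB // ler_norml => /andP[hm _].
  have al1 : al <= 1 by apply: le_trans al4 _; rewrite ler_pdivrMr // mul1r ler1n.
  apply: le_trans (size_bound al0 al1 t0 t64 xt1 zx2 Ext) _.
  by rewrite lerD2r ler_wpM2l // -(lerD2r (- (N%:R - z%:R))) addrAC subrr sub0r.
- move=> d d0 dN.
  have dN2 : (2 * d <= N)%N.
    by rewrite -(ler_nat R) natrM mulrC -ler_pdivlMr.
  (* Every progression would have to start inside the empty segment, so the count is 0. *)
  have [Nz|zN2] := leqP (N - 2 * d) z.
    have -> : num_3AP A d = 0%N.
      apply/eqP; rewrite cardfs_eq0; apply/eqP/fsetP => x.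
      rewrite !inE; apply/negbTE/negP => /and3P[/Az /andP[h1 _] _ /Az /andP[_ h2]].
      by move: Nz h1 h2; clear; lia.
    rewrite mulr_ge0 // subr_ge0; last by rewrite -natrM ler_nat.
    apply: le_trans eps_r; rewrite ler_peMl ?(ltW eps0) // mulr_ege1 ?exprn_ege1 ?ler1n //.
  have uv : (z.+1 <= N.+1 - 2 * d)%N by move: zN2; clear; lia.
  have dN' : (0 < d < N)%N by rewrite d0 (leq_trans _ dN2) // mul2n -addnn -addn1 leq_add2l.
  have -> : N%:R - 2 * d%:R = (N.+1 - 2 * d - z.+1)%:R + z%:R :> R.
    rewrite -natrD -natrM -natrB //; congr _%:R; by move: uv; clear; lia.
  apply: (count_bound al0 t0 t64 (eta := 1 / r%:R ^+ 4) (x := N%:R) (E := N%:R / r%:R ^+ 12)) => //.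
  + by have [] := scale_gain r64.
  + by have [] := scale_gain r64.
  + by rewrite mulrA mulr1 -mulrA -invfM ler_pdivlMr ?mulr_gt0 // mulrC [X in X * _]mulrC.
  + apply: le_trans (lowA d d0) _; rewrite lerD2r.
    have -> : \sum_(z.+1 <= n < N.+1 - 2 * d) q n * q (n + d)%N * q (n + 2 * d)%N
       = al' ^+ 3 * \sum_(z.+1 <= n < N.+1 - 2 * d) F n * F (n + d)%N * F (n + 2 * d)%N.
      by rewrite mulr_sumr; apply: eq_bigr => n _; rewrite /q; ring.
    apply: ler_wpM2l; last exact: Flow.
    by rewrite exprn_ge0.
Qed.

End Assembly.

(** The largest power of 7 meeting both upper constraints; maximality yields the final disjunction.
    A power between [1 / al] and [8 / al] is admissible, which is where [eps <= al ^+ 12] and the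
    lower bound on [N] enter. *)
Lemma exists_scale (R : realType) (al eps : R) N :
  0 < al -> al <= 2^-1 ^+ 40 -> 0 < eps -> eps <= al ^+ 12 -> 8 ^+ 40 <= al ^+ 40 * N%:R ->
  exists a, [/\ 1 <= (7 ^ a)%:R * al, 4 * (7 ^ a)%:R ^+ 4 * eps <= al ^+ 3,
    ((7 ^ a) ^ 40 <= N)%N &
    (N < (7 * 7 ^ a) ^ 40)%N \/ al ^+ 3 < 4 * (7 * (7 ^ a)%:R) ^+ 4 * eps].
Proof.
move=> al0 al40 eps0 eps12 big.
have al14 : al * 2 ^+ 14 <= 1.
  apply: le_trans (_ : 2^-1 ^+ 40 * 2 ^+ 14 <= _); first by rewrite ler_pM2r ?exprn_gt0.
  by rewrite exprVn mulrC ler_pdivrMr ?exprn_gt0 // mul1r ler_weXn2l // ler1n.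
have al7 : 7 <= 1 / al.
  rewrite ler_pdivlMr //; apply: le_trans al14; rewrite mulrC ler_pM2l //.
  by apply: le_trans (_ : 2 ^+ 3 <= _); [lra|rewrite ler_weXn2l // ler1n].
have al1 : al <= 1.
  by apply: le_trans al14; rewrite ler_peMr ?(ltW al0) // exprn_ege1 // ler1n.
pose P a := (((7 ^ a) ^ 40 <= N)%N && (4 * (7 ^ a)%:R ^+ 4 * eps <= al ^+ 3)).
have [X /andP[X1 X2]] := @exists_nat_ceil R (1 / al) (ltW (divr_gt0 ltr01 al0)).
have X0 : (0 < X)%N by rewrite -(ltr_nat R); apply: lt_le_trans X1; rewrite divr_gt0.
have [a0 /andP[Xa aX]] := exists_pow_between (isT : (1 < 7)%N) X0.
have a8 : (7 ^ a0)%:R <= 8 / al :> R.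
  apply: le_trans (_ : (7 * X)%:R <= _); first by rewrite ler_nat ltnW.
  have -> : 8 / al = 8 * (1 / al) by rewrite mul1r.
  by rewrite natrM; lra.
have p0 a : 0 <= (7 ^ a)%:R :> R by [].
have Pa0 : P a0.
  apply/andP; split.
    rewrite -(ler_nat R) natrX; apply: le_trans (_ : (8 / al) ^+ 40 <= _).
      by rewrite lerXn2r ?nnegrE // divr_ge0 // ltW.
    by rewrite expr_div_n ler_pdivrMr ?exprn_gt0 // mulrC.
  apply: le_trans (_ : 4 * (8 / al) ^+ 4 * al ^+ 12 <= _).
    rewrite ler_pM ?mulr_ge0 ?exprn_ge0 ?(ltW eps0) //.
    by rewrite ler_pM2l // lerXn2r ?nnegrE // divr_ge0 // ltW.
  have -> : 4 * (8 / al) ^+ 4 * al ^+ 12 = al ^+ 3 * (al ^+ 4 * (al * (4 * 8 ^+ 4))).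
    by field; rewrite gt_eqF.
  rewrite ler_piMr ?exprn_ge0 ?(ltW al0) // mulr_ile1 ?exprn_ge0 ?mulr_ge0 ?(ltW al0) //.
    by rewrite exprn_ile1 // ltW.
  apply: le_trans al14; rewrite ler_pM2l //; lra.
have Pub a : P a -> (a <= N)%N.
  move=> /andP[aN _]; apply: leq_trans aN; apply: leq_trans (ltnW (ltn_expl a (isT : (1 < 7)%N))) _.
  by rewrite -{1}[(7 ^ a)%N]expn1 leq_pexp2l // expn_gt0.
case: (ex_maxnP (ex_intro _ a0 Pa0) Pub) => a /andP[Pa1 Pa2] amax.
exists a; split=> //.
  rewrite -ler_pdivrMr //; apply: le_trans X1 _; rewrite ler_nat.
  apply: leq_trans Xa _; rewrite leq_exp2l //; exact: amax.
have : ~~ P a.+1 by apply/negP => /amax; rewrite ltnn.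
rewrite /P negb_and -ltnNge -ltNge (expnS 7 a) natrM => /orP[|]; first by left.
by right.
Qed.

(** The fourth power of the last hypothesis, combined with [eps <= al ^+ 12], shows that [r ^ 16] is
    at least a constant times [eps ^ -3], hence at least [3 ^ 16 / eps]. The factor [16 * ln 1025]
    makes [1025 ^ (16 s) <= 1 / eps]. *)
Lemma levels_le (R : realType) (al eps r : R) :
  0 < al -> al <= 1 -> al <= 2^-1 ^+ 40 -> 0 < eps -> eps <= al ^+ 12 -> 0 < r ->
  al ^+ 3 < 4 * (7 * r) ^+ 4 * eps ->
  3 * 1025 ^+ (Num.truncn (1 / (16 * ln 1025) * ln (1 / eps))) <= r.
Proof.
move=> al0 al_1 al40 eps0 epsle r0 epsr; set s := Num.truncn _.
have l0 : 0 < ln 1025 :> R by rewrite ln_gt0 // ltr1n.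
have eps1 : eps <= 1 by apply: le_trans epsle _; rewrite exprn_ile1 // ltW.
have le0 : 0 <= ln (1 / eps) by rewrite ln_ge0 // ler_pdivlMr // mul1r.
have hs : (1025 : R) ^+ s ^+ 16 <= 1 / eps.
  rewrite -exprM -ler_ln ?posrE ?exprn_gt0 ?divr_gt0 // lnXn // -[_ *+ (s * 16)]mulr_natr natrM.
  have : s%:R <= 1 / (16 * ln 1025) * ln (1 / eps).
    have /andP[] := truncn_itv (mulr_ge0 (ltW (divr_gt0 ltr01 (mulr_gt0 (ltr0n _ 16) l0))) le0).
    by [].
  rewrite mulrAC mul1r ler_pdivlMr ?mulr_gt0 //; lra.
rewrite -(@ler_pXn2r R 16) // ?nnegrE ?mulr_ge0 ?exprn_ge0 ?(ltW r0) //.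
rewrite exprMn.
apply: le_trans (_ : 3 ^+ 16 * (1 / eps) <= _); first by rewrite ler_pM2l ?exprn_gt0.
have r16 : 1 <= 256 * (7 * r) ^+ 16 * eps ^+ 3.
  have h : (al ^+ 3) ^+ 4 <= (4 * (7 * r) ^+ 4 * eps) ^+ 4.
    by rewrite lerXn2r ?nnegrE ?exprn_ge0 ?mulr_ge0 ?(ltW al0) ?(ltW eps0) ?exprn_ge0 // ltW.
  rewrite -(ler_pM2r eps0) mul1r; apply: le_trans epsle _.
  by rewrite -exprM in h; apply: le_trans h _; rewrite le_eqVlt; apply/orP; left; apply/eqP; ring.
have epss : 21 ^+ 16 * 256 * eps ^+ 2 <= 1.
  have e44 : eps <= 2^-1 ^+ 44.
    apply: le_trans epsle _; apply: le_trans (_ : (2^-1 ^+ 40) ^+ 12 <= _).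
      by rewrite lerXn2r ?nnegrE ?exprn_ge0 ?invr_ge0 // ltW.
    by rewrite -exprM ler_wiXn2l ?invr_ge0 // invf_le1 // ler1n.
  apply: le_trans (_ : 2 ^+ 80 * 2 ^+ 8 * (2^-1 ^+ 44) ^+ 2 <= _); last first.
    by rewrite -exprM -exprD -[(44 * 2)%N]/(80 + 8)%N -exprMn mulfV ?expr1n ?pnatr_eq0.
  rewrite ler_pM ?mulr_ge0 ?exprn_ge0 ?(ltW eps0) //.
    rewrite ler_pM ?exprn_ge0 //; last by rewrite le_eqVlt; apply/orP; left; apply/eqP; ring.
    have -> : 2 ^+ 80 = (2 ^+ 5) ^+ 16 :> R by rewrite -exprM.
    have h16 (x y : R) : 0 <= x -> x <= y -> x ^+ 16 <= y ^+ 16.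
      by move=> x0 xy; rewrite lerXn2r ?nnegrE // (le_trans x0).
    by apply: h16; rewrite ?ler0n // -natrX ler_nat.
  by rewrite lerXn2r ?nnegrE ?exprn_ge0 ?invr_ge0 // ltW.
rewrite mulrA mulr1 ler_pdivrMr //.
rewrite -(@ler_pM2l R (256 * 7 ^+ 16 * eps ^+ 2)); last by rewrite !mulr_gt0 ?exprn_gt0.
apply: le_trans (_ : 21 ^+ 16 * 256 * eps ^+ 2 <= _).
  rewrite le_eqVlt; apply/orP; left; apply/eqP.
  have -> : 21 ^+ 16 = 7 ^+ 16 * 3 ^+ 16 :> R by rewrite -exprMn; congr (_ ^+ _); ring.
  by ring.
apply: le_trans epss _; apply: le_trans r16 _.
by rewrite le_eqVlt; apply/orP; left; apply/eqP; rewrite exprMn; ring.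
Qed.

Local Open Scope fset_scope.

Theorem theorem1p5 (R : realType) :
  exists c alpha0 : R, [/\ 0 < c, 0 < alpha0 &
    forall alpha : R, 0 < alpha -> alpha <= alpha0 ->
    forall eps : R, 0 < eps -> eps <= alpha ^+ 12 ->
    forall N : nat, (0 < N)%N -> (N <= towerR (c * ln (1 / eps)))%N ->
    exists A : {fset nat}, [/\ A `<=` interval1 N,
      alpha * N%:R <= #|` A|%:R &
      forall d : nat, (0 < d)%N -> d%:R <= N%:R / 2 :> R ->
        (num_3AP A d)%:R <= (alpha ^+ 3 - eps) * (N%:R - 2 * d%:R)]].
Proof.
have [r0 hr0] := scale_threshold.
have [al1 al10 sparse] := @sparse_AP_free R 80 isT.
have l0 : 0 < ln 1025 :> R by rewrite ln_gt0 // ltr1n.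
exists (1 / (16 * ln 1025)), (Num.min al1 (Num.min (1 / r0.+1%:R) (2^-1 ^+ 40))).
split; first by rewrite divr_gt0 // mulr_gt0.
  by rewrite !lt_min al10 divr_gt0 //= exprn_gt0 // invr_gt0.
move=> al al0; rewrite !le_min => /and3P[ale1 aler al40] eps eps0 epsle N N0 NT.
have al8 : 8 * al <= 1.
  apply: le_trans (_ : 8 * 2^-1 ^+ 40 <= _); first by rewrite ler_pM2l.
  rewrite exprVn ler_pdivrMr ?exprn_gt0 // mul1r.
  by apply: le_trans (_ : 2 ^+ 3 <= _); [lra|rewrite ler_weXn2l // ler1n].
have al4 : al <= 1 / 4 by lra.
have al_1 : al <= 1 by lra.
have c3 : 3 <= 2 ^+ 24 :> R.
  by apply: le_trans (_ : 2 ^+ 2 <= _); [lra|rewrite ler_weXn2l // ler1n].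
(* In the small case [al ^+ 80 * N <= (8 * al) ^+ 40 <= 1], whence the exponent 80 given to
   [sparse_AP_free]. *)
have [big|small] := leP (8 ^+ 40) (al ^+ 40 * N%:R); last first.
  have [|A [AN cA APA]] := sparse al N al0 ale1 N0.
    rewrite -[80%N]/(40 + 40)%N exprD -mulrA.
    apply: le_trans (_ : al ^+ 40 * 8 ^+ 40 <= _); first by rewrite ler_pM2l ?exprn_gt0 // ltW.
    by rewrite -exprMn mulrC exprn_ile1 // mulr_ge0 // ltW.
  exists A; split=> // d d0 dN; rewrite APA // mulr_ge0 // subr_ge0.
    by apply: le_trans epsle _; rewrite ler_wiXn2l // ltW.
  by rewrite mulrC -ler_pdivlMr.
have [a [ral eps_r rN lim]] := exists_scale al0 al40 eps0 epsle big.
set r := (7 ^ a)%N in ral eps_r rN lim *.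
have r0r : (r0 <= r)%N.
  rewrite -(ler_nat R); apply: le_trans (_ : r0.+1%:R <= _); first by rewrite ler_nat.
  move: aler; rewrite ler_pdivlMr ?ltr0n // => h.
  rewrite -(ler_pM2l al0); apply: le_trans h _; rewrite mulrC //.
have [r24 rdom rbase] := hr0 r r0r.
have rR : 2 ^+ 24 <= r%:R :> R by rewrite -natrX ler_nat.
have r3 : 3 <= r%:R :> R := le_trans c3 rR.
have r7 : (7 <= r)%N.
  by apply: leq_trans r24; apply: (@leq_trans (2 ^ 3)) => //; rewrite leq_exp2l.
(* If [N] stopped the growth of [r], then [N] is below [r ^ 80] and no refinement beyond the base
   range is needed; if [eps] did, then [r] allows as many levels as the tower is high. *)
case: lim => [Nr|epsr].
  apply: (@main_case _ al eps N a 0) => //; first by rewrite expr0 mulr1.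
  rewrite muln1; apply: leq_trans (ltnW Nr) _; apply: (@leq_trans ((r ^ 2) ^ 40)).
    by rewrite leq_exp2r // -mulnn leq_mul2r r7 orbT.
  by rewrite -expnM leq_pexp2l // expn_gt0.
apply: (@main_case _ al eps N a (Num.truncn (1 / (16 * ln 1025) * ln (1 / eps)))) => //; last first.
  by apply: leq_trans NT _; rewrite leq_pmull // !expn_gt0.
apply: levels_le epsr => //; exact: lt_le_trans r3.
Qed.
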